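(* Let $J,\eta,\rho,\tau,V=J_\tau,R$ and the on-period steady-state transform $\tilde Y^\tau(\alpha)$ be as in the context, and assume $E\frac{V}{R-\rho}<\infty$. Let $U,N,e_1,e_2,\ldots$ be independent random variables such that $U\sim U[0,1]$ and $\{e_n;\,n\ge1\}$ is an i.i.d. sequence of nonnegative random variables with $Ee^{-\alpha e_1}=\frac{\eta(\alpha)}{\rho\alpha}$ for every $\alpha\ge 0$ (value at $\alpha=0$ understood as the limit $1$). In addition, let $U,e_1,e_2,\ldots$ be independent of $(V,R)$, and let the conditional distribution of $N+1$ given $(V,R)$ be geometric with success probability $1-\frac{\rho}{R}$, i.e. $P(N=n\mid V,R)=\left(1-\frac{\rho}{R}\right)\left(\frac{\rho}{R}\right)^n$ for $n=0,1,2,\ldots$. Then for every $\alpha\ge 0$ $$\tilde Y^\tau(\alpha)=\frac{E\left[\frac{1-e^{-\alpha V}}{\alpha R-\eta(\alpha)}\right]}{E\left(\frac{V}{R-\rho}\right)}=E_{V,R}\exp\left\{-\alpha\left(UV+\sum_{i=1}^N e_i\right)\right\},$$ where at $\alpha=0$ the quotient $\frac{1-e^{-\alpha V}}{\alpha R-\eta(\alpha)}$ is understood as its limit $\frac{V}{R-\rho}$.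
   Context: Let $(\Omega,\mathcal F,P)$ be a probability space with a filtration $\mathbb F=(\mathcal F_t)_{t\ge 0}$ satisfying the usual conditions. $J=(J_t)_{t\ge0}$ is a subordinator with respect to $\mathbb F$: adapted, nondecreasing, right-continuous, $J_0=0$, with stationary increments, $J_{t+s}-J_t$ being independent of $\mathcal F_t$. It satisfies $Ee^{-\alpha J_t}=e^{-\eta(\alpha)t}$ for $\alpha,t\ge 0$, with $\eta(\alpha)=c\alpha+\int_{(0,\infty)}(1-e^{-\alpha x})\nu(dx)$, $c\ge0$, $\int_{(0,\infty)}(x\wedge 1)\nu(dx)<\infty$, and has finite mean $\rho=EJ_1=\eta'(0)=c+\int_{(0,\infty)}x\,\nu(dx)<\infty$. Model (first cycle of a regenerative storage process). $\tau$ is an $\mathbb F$-stopping time with $E\tau<\infty$ and $V:=J_\tau>0$ almost surely. During $[0,\tau)$ (off period) there is no output and the workload is $J_t$. At time $\tau$ an output rate $R$ is chosen, an $\mathcal F_\tau$-measurable random variable with $R>\rho$ a.s. From time $\tau$ on (on period) the workload is $J_t-R(t-\tau)$, until the first time $\tau+T^\tau$ at which it hits $0$; then a new cycle starts. The on-period process is $Y^\tau_s=J_{\tau+s}-Rs$ for $0\le s\le T^\tau$ in the first cycle, with i.i.d. cycles concatenated. $\tilde Y^\tau$ denotes its steady-state (long-run time-average) distribution, whose Laplace–Stieltjes transform is $\tilde Y^\tau(\alpha)=\frac{E\int_0^{T^\tau}e^{-\alpha Y^\tau_s}ds}{ET^\tau}$. When $E\frac{V}{R-\rho}<\infty$, $P_{V,R}$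 is the probability measure $P_{V,R}(A)=\frac{E\left[\frac{V}{R-\rho}1_A\right]}{E\left[\frac{V}{R-\rho}\right]}$ for $A\in\mathcal F$, and $E_{V,R}$ is expectation with respect to it, i.e. $E_{V,R}S=\frac{E\left(\frac{V}{R-\rho}S\right)}{E\left(\frac{V}{R-\rho}\right)}$ for every random variable $S$ for which this expectation exists.
   Formalization: Independence is taken as mutual independence of U, the triple (V,R,N), e_1, e_2, …; the listed independences alone do not suffice (e.g. N may be a function of U+F(V) mod 1, F the cdf of V). *)

(* Defs.v *)
From HB Require Import structures.
From mathcomp Require Import all_boot all_order all_algebra.
From mathcomp Require Import all_classical all_reals all_analysis.

Set Implicit Arguments.
Unset Strict Implicit.
Unset Printing Implicit Defensive.

Import Order.TTheory GRing.Theory Num.Theory.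
Import numFieldNormedType.Exports.

Local Open Scope classical_set_scope.
Local Open Scope ring_scope.

Section sigma_algebras_and_independence.
Context (d : measure_display) (Omega : measurableType d) (R : realType).
Variable P : probability Omega R.

Definition sigma_gen d' (T : measurableType d') (X : Omega -> T) :
  set (set Omega) := preimage_set_system setT X measurable.

Definition indep_events (G H : set (set Omega)) : Prop :=
  forall A B, G A -> H B -> P (A `&` B) = (P A * P B)%E.

Definition mutually_indep (G : nat -> set (set Omega)) : Prop :=
  forall (s : seq nat) (A : nat -> set Omega), uniq s ->
    (forall i, i \in s -> G i (A i)) ->
    P (\bigcap_(i in [set` s]) A i) = (\prod_(i <- s) P (A i))%E.

(* [w |-> g (X w)] is a version of the conditional probability P(A | X). *)
Definition is_cond_prob d' (T : measurableType d') (A : set Omega)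
    (X : Omega -> T) (g : T -> R) : Prop :=
  measurable_fun setT g /\
  forall C, measurable C ->
    P (A `&` X @^-1` C) = (\int[P]_(w in X @^-1` C) (g (X w))%:E)%E.

Definition laplace (X : Omega -> R) (a : R) : \bar R :=
  ('E_P[fun w => expR (- (a * X w))])%E.

End sigma_algebras_and_independence.

(* Time-indexed objects are functions on R of which only the restriction to
   [0, +oo[ is constrained or used. *)
Section filtrations.
Context (d : measure_display) (Omega : measurableType d) (R : realType).
Variables (P : probability Omega R) (F : R -> set (set Omega)).

Record is_filtration : Prop := IsFiltration {
  filtration_sigma_algebra : forall t, 0 <= t -> sigma_algebra setT (F t) ;
  filtration_measurable : forall t, 0 <= t -> F t `<=` measurable ;
  filtration_nondecreasing :
    forall s t, 0 <= s -> s <= t -> F s `<=` F t }.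

(* [P.-negligible] sets are arbitrary subsets of null events, so the first
   clause also forces (Omega, measurable, P) to be complete. *)
Record usual_conditions : Prop := UsualConditions {
  usual_complete : P.-negligible `<=` F 0 ;
  usual_right_continuous :
    forall t, 0 <= t -> F t = \bigcap_(s in [set s | t < s]) F s }.

Definition is_stopping_time (tau : Omega -> \bar R) : Prop :=
  (forall w, (0 <= tau w)%E) /\
  forall t, 0 <= t -> F t [set w | (tau w <= t%:E)%E].

Definition stopped_sigma (tau : Omega -> \bar R) : set (set Omega) :=
  [set A | measurable A /\
    forall t, 0 <= t -> F t (A `&` [set w | (tau w <= t%:E)%E])].

Definition laplace_exponent (c : R) (nu : {measure set R -> \bar R})
    (a : R) : R :=
  c * a + \int[nu]_(x in `]0, +oo[) (1 - expR (- (a * x))).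

Record is_levy_pair (c : R) (nu : {measure set R -> \bar R}) : Prop :=
  IsLevyPair {
  levy_drift_ge0 : 0 <= c ;
  levy_integrable :
    (\int[nu]_(x in [set` `]0%R, +oo[%R]) (Num.min x 1)%:E < +oo)%E }.

Record is_subordinator (J : R -> Omega -> R) (c : R)
    (nu : {measure set R -> \bar R}) : Prop := IsSubordinator {
  subord_adapted : forall t, 0 <= t -> sigma_gen (J t) `<=` F t ;
  subord0 : forall w, J 0 w = 0 ;
  subord_nondecreasing :
    forall w s t, 0 <= s -> s <= t -> J s w <= J t w ;
  subord_right_continuous :
    forall w t, 0 <= t -> J ^~ w x @[x --> t^'+] --> J t w ;
  subord_stationary : forall t s, 0 <= t -> 0 <= s ->
    forall B : set R, measurable B ->
    P ((fun w => J (t + s) w - J t w) @^-1` B) =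
    P ((fun w => J s w - J 0 w) @^-1` B) ;
  subord_indep : forall t s, 0 <= t -> 0 <= s ->
    indep_events P (sigma_gen (fun w => J (t + s) w - J t w)) (F t) ;
  subord_levy : is_levy_pair c nu ;
  subord_laplace : forall a t, 0 <= a -> 0 <= t ->
    laplace P (J t) a = (expR (- (laplace_exponent c nu a * t)))%:E }.

End filtrations.

Section storage.
Context (d : measure_display) (Omega : measurableType d) (R : realType).
Variables (P : probability Omega R) (J : R -> Omega -> R).
Variables (tau : Omega -> \bar R) (rate : Omega -> R).

Definition mean_rate : R := fine ('E_P[J 1%R])%E.

(* tau is almost surely finite where this is used; on the null event
   {tau = +oo} the value is J_0. *)
Definition level_at_tau (w : Omega) : R := J (fine (tau w)) w.

Definition on_process (s : R) (w : Omega) : R :=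
  J (fine (tau w) + s) w - rate w * s.

(* The infimum of the empty set is +oo. *)
Definition on_duration (w : Omega) : \bar R :=
  ereal_inf [set s%:E | s in [set s : R | 0 <= s /\ on_process s w = 0]].

Definition on_transform (a : R) : \bar R :=
  ((\int[P]_w \int[lebesgue_measure]_(s in
       [set s : R | (0 <= s)%R /\ s%:E <= on_duration w])
       (expR (- (a * on_process s w)))%:E)
   / (\int[P]_w on_duration w))%E.

Definition weight (w : Omega) : R :=
  level_at_tau w / (rate w - mean_rate).

(* Expectation under the measure with density weight / E weight. *)
Definition E_VR (S : Omega -> R) : \bar R :=
  ('E_P[fun w => (weight w * S w)%R] / 'E_P[weight])%E.

(* (1 - e^{-aV}) / (aR - eta a), with its limit V / (R - rho) at a = 0. *)
Definition transform_quotient (eta : R -> R) (a : R) (w : Omega) : R :=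
  if a == 0 then weight w
  else (1 - expR (- (a * level_at_tau w))) / (a * rate w - eta a).

(* eta a / (rho a), with its limit 1 at a = 0. *)
Definition excess_laplace (eta : R -> R) (a : R) : R :=
  if a == 0 then 1 else eta a / (mean_rate * a).

(* The independent sources: U, the triple (V, R, N), then e_1, e_2, ...
   N depends on (V, R), so these three enter through their joint
   sigma-algebra. *)
Definition source_sigma (U : Omega -> R) (N : Omega -> nat)
    (e : nat -> Omega -> R) (i : nat) : set (set Omega) :=
  match i with
  | 0%N => sigma_gen U
  | 1%N => sigma_gen (fun w => (level_at_tau w, rate w, N w))
  | n.+2 => sigma_gen (e n)
  end.

End storage.

(* Main.v *)
Require Import Defs.
From HB Require Import structures.
From mathcomp Require Import all_boot all_order all_algebra.
From mathcomp Require Import all_classical all_reals all_analysis.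
From mathcomp Require Import measurable_realfun.
From mathcomp Require Import ring lra.

Set Implicit Arguments.
Unset Strict Implicit.
Unset Printing Implicit Defensive.

Import Order.TTheory GRing.Theory Num.Theory.
Import numFieldNormedType.Exports.

Local Open Scope classical_set_scope.
Local Open Scope ring_scope.

(* By the strong Markov property at [tau], the discount [exp (- a Y_s)] grows in
   conditional mean like [exp (phi s)], where [phi = a R - eta a]. So if [S] is
   the first point of a grid at which [Y] lies below a threshold,
     [E int_0^S exp (- a Y_s) ds = E [(exp (- a Y_S) - exp (- a V)) / phi]].
   As [Y] decreases at speed at most [R], on a grid of step [h] the threshold [0]
   gives [S >= T] and the threshold [R h] gives [S <= T], while [exp (- a Y_S)]
   tends to [1] with [h]; this encloses the integral up to [T] without requiring
   [T] to be a stopping time, or even measurable. The case [a = 0] follows by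
   letting [a] decrease to [0], as [eta a / a] tends to [rho].
   For the compound geometric form, put [q = eta a / (rho a)]: given [V], [R] and
   [N = n], the sum of the [e_i] contributes [q ^ n] and [U V] contributes
   [(1 - exp (- a V)) / (a V)], and the geometric series in [n] sums to
   [a (R - rho) / phi]. *)

(** * Integration *)

(** Two obstacles shape the estimates. On the stable event [1 / phi] need not be integrable and the
    overshoot factor [exp (a R h)] is not uniform in [R]; both are under control where
    [R - rho >= 1 / (j + 1)] and [R <= j], so the bounds are proved on such events and extended by
    monotone limits in [j]. Moreover the lower bound needs the grid time [S] to be almost surely
    finite, which is not assumed. This is drawn from the upper bound, which holds without it: there
    the limit [a -> 0] bounds the mean busy time by [E (V / (R - rho))], and Markov's inequality
    makes the probability of surviving [n] steps tend to [0]. The upper bound and its limit at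
    [a = 0] therefore have to precede the lower bound even for [a > 0]. No conditional expectation
    is formed: every conditioning is an equality between the integrals of two densities over the
    events of a sigma-algebra, transported to nonnegative integrands. Likewise [S] is never defined
    as a random variable; only the events that it exceeds a given grid index are used. *)

Section density_measure.
Local Open Scope ereal_scope.
Context d (T : measurableType d) (R : realType).
Variables (mu : {measure set T -> \bar R}) (Z : T -> R).
Hypotheses (mZ : measurable_fun setT Z) (Z0 : forall x, (0 <= Z x)%R).

(** Both proofs are arguments so that the measure instance, which is built from them, can be
    inferred from the term. *)
Definition density_measure of measurable_fun setT Z & (forall x, (0 <= Z x)%R) :=
  fun A : set T => \int[mu]_(x in A) (Z x)%:E.

Local Notation nu := (density_measure mZ Z0).

Let nu0 : nu set0 = 0.
Proof. by rewrite /density_measure integral_set0. Qed.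

Let nu_ge0 A : 0 <= nu A.
Proof. by apply: integral_ge0 => x _; rewrite lee_fin. Qed.

Let mEZ (D : set T) : measurable_fun D (fun x => (Z x)%:E).
Proof. by apply: measurable_funTS; exact/measurable_EFinP. Qed.

Let nu_sigma_additive : semi_sigma_additive nu.
Proof.
move=> F mF tF mUF; rewrite /density_measure.
rewrite ge0_integral_bigcup//; last by move=> x _; rewrite lee_fin.
apply: is_cvg_ereal_nneg_natsum_cond => n _ _.
by apply: integral_ge0 => x _; rewrite lee_fin.
Qed.

HB.instance Definition _ := isMeasure.Build d T R nu nu0 nu_ge0
  nu_sigma_additive.

Import HBNNSimple.

(** Both sides are limits along [nnsfun_approx] by monotone convergence; for a simple function the
    identity is additivity over its level sets. *)
Lemma integral_density (f : T -> \bar R) :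
  measurable_fun setT f -> (forall x, 0 <= f x) ->
  \int[nu]_x f x = \int[mu]_x (f x * (Z x)%:E).
Proof.
move=> mf f0.
pose g := nnsfun_approx measurableT mf.
have gf x : (EFin \o g^~ x) @ \oo --> f x by exact: cvg_nnsfun_approx.
have ndg x : nondecreasing_seq (fun n => (g n x)%:E).
  by move=> m n mn; rewrite lee_fin; exact/lefP/nd_nnsfun_approx.
transitivity (limn (fun n => \int[nu]_x (g n x)%:E)).
  rewrite -monotone_convergence//.
  - by apply: eq_integral => x _; apply/esym/cvg_lim => //; exact: gf.
  - by move=> n; exact/measurable_EFinP/measurable_funP.
  - by move=> n x _; rewrite lee_fin.
transitivity (limn (fun n => \int[mu]_x ((g n x)%:E * (Z x)%:E))); last first.
  rewrite -monotone_convergence//.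
  - apply: eq_integral => x _; apply/cvg_lim => //.
    by apply: cvgeZr => //; exact: gf.
  - move=> n; apply: emeasurable_funM => //.
    by apply/measurable_EFinP/measurable_funP.
  - by move=> n x _; rewrite mule_ge0// lee_fin.
  - by move=> x _ m n mn; rewrite lee_wpmul2r// ?lee_fin//; exact: ndg.
congr (limn _); apply/funext => n.
rewrite integralT_nnsfun sintegralE.
transitivity (\int[mu]_x (\sum_(r \in range (g n))
    (r * \1_(g n @^-1` [set r]) x)%:E * (Z x)%:E)); last first.
  apply: eq_integral => x _.
  by rewrite [in RHS]fimfunE -fsumEFin// ge0_mule_fsuml// => r; exact: nnfun_muleindic_ge0.
rewrite ge0_integral_fsum//.
- apply: eq_fsbigr => r; rewrite inE => -[y _ <-].
  rewrite /= /density_measure -ge0_integralZl_EFin//; last first.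
    by move=> x _; rewrite lee_fin.
  rewrite [LHS]integral_mkcond; apply: eq_integral => x _ /=.
  rewrite patchE indicE.
  by case: ifPn => _; rewrite ?mulr1 ?mulr0 ?mul0e.
- move=> r; apply: emeasurable_funM => //; apply/measurable_EFinP.
  by apply: measurable_funM => //; exact: measurable_indic.
- by move=> r x _; rewrite mule_ge0 ?lee_fin//; exact: nnfun_muleindic_ge0.
Qed.

End density_measure.

Section transfer.
Local Open Scope ereal_scope.
Context d (T : measurableType d) (R : realType).
Variables (mu : {measure set T -> \bar R}).

(** Elementary substitute for conditional expectation: the measures with densities [Z1] and [Z2]
    have the same image under [X]. It serves for independence ([Z2] constant), for the strong Markov
    property ([X] the identity into a smaller sigma-algebra) and for the law of [N] given
    [(V, R)]. *)
Lemma integral_comp_density d' (T' : measurableType d') (X : T -> T')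
    (Z1 Z2 : T -> R) (f : T' -> \bar R) :
  measurable_fun setT X ->
  measurable_fun setT Z1 -> measurable_fun setT Z2 ->
  (forall x, (0 <= Z1 x)%R) -> (forall x, (0 <= Z2 x)%R) ->
  (forall B, measurable B -> \int[mu]_(x in X @^-1` B) (Z1 x)%:E =
     \int[mu]_(x in X @^-1` B) (Z2 x)%:E) ->
  measurable_fun setT f -> (forall y, 0 <= f y) ->
  \int[mu]_x (f (X x) * (Z1 x)%:E) = \int[mu]_x (f (X x) * (Z2 x)%:E).
Proof.
move=> mX mZ1 mZ2 Z10 Z20 Z12 mf f0.
have key (Z : T -> R) (mZ : measurable_fun setT Z) (Z0 : forall x, (0 <= Z x)%R) :
    \int[mu]_x (f (X x) * (Z x)%:E) =
    \int[pushforward (density_measure mu mZ Z0) X]_y f y.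
  transitivity (\int[density_measure mu mZ Z0]_x f (X x)).
    by rewrite integral_density//; exact: measurableT_comp.
  by rewrite ge0_integral_pushforward.
rewrite (key _ mZ1 Z10) (key _ mZ2 Z20).
apply: eq_measure_integral => A mA _.
exact: (Z12 _ mA).
Qed.

End transfer.

Section nonmeasurable_integrand.
Local Open Scope ereal_scope.
Context d (T : measurableType d) (R : realType).
Variables (mu : {measure set T -> \bar R}).

(** The integral of a nonnegative function is a supremum over the simple functions below it, and a
    larger function admits more of them. *)
Lemma le_integral_nonmeasurable (f g : T -> \bar R) :
  (forall x, 0 <= f x) -> (forall x, f x <= g x) ->
  \int[mu]_x f x <= \int[mu]_x g x.
Proof.
move=> f0 fg; have g0 x : 0 <= g x by exact: le_trans (fg x).
rewrite !ge0_integralTE//; apply: le_ereal_sup => _ [h hf <-].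
by exists h => // x; exact: le_trans (fg x).
Qed.

Lemma integral_sandwich (f g1 g2 : T -> \bar R) (v : \bar R) :
  (forall x, 0 <= f x) -> (forall x, 0 <= g1 x) -> (forall x, 0 <= g2 x) ->
  measurable_fun setT g1 -> measurable_fun setT g2 ->
  {ae mu, forall x, g1 x <= f x <= g2 x} ->
  v <= \int[mu]_x g1 x -> \int[mu]_x g2 x <= v ->
  \int[mu]_x f x = v.
Proof.
move=> f0 g10 g20 mg1 mg2 [N [mN N0 sub]] v1 v2.
have gf x : ~ N x -> g1 x <= f x <= g2 x.
  by move=> Nx; apply: contrapT => h; apply/Nx/sub.
(* As [f] may fail to be measurable, it cannot be altered on a null set. Instead the bounds become
   [0] and [+oo] on [N], where they hold trivially, at no cost to their integrals. *)
pose G1 := g1 \_ (~` N); pose G2 x := if x \in N then +oo else g2 x.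
have G10 x : 0 <= G1 x by rewrite /G1 patchE; case: ifPn.
have G20 x : 0 <= G2 x by rewrite /G2; case: ifPn.
have mG1 : measurable_fun setT G1.
  apply/(measurable_restrictT _ _).1; first exact: measurableC.
  exact: measurable_funTS.
have mG2 : measurable_fun setT G2.
  apply: measurable_fun_ifT => //; apply: (measurable_fun_bool true).
  rewrite setTI (_ : _ @^-1` _ = N)//.
  by apply/seteqP; split => x /=; [move=> /set_mem|move=> /mem_set].
have aeq (g h : T -> \bar R) : (forall x, ~ N x -> g x = h x) -> ae_eq mu setT g h.
  move=> gh; exists N; split => // x /= /not_implyP[_ ne].
  by apply: contrapT => /gh.
have i1 : \int[mu]_x g1 x = \int[mu]_x G1 x.
  apply: ge0_ae_eq_integral => //; apply: aeq => x Nx.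
  by rewrite /G1 patchE mem_set.
have i2 : \int[mu]_x g2 x = \int[mu]_x G2 x.
  apply: ge0_ae_eq_integral => //; apply: aeq => x Nx.
  by rewrite /G2 memNset.
apply/eqP; rewrite eq_le; apply/andP; split.
  apply: le_trans v2; rewrite i2; apply: le_integral_nonmeasurable => // x.
  rewrite /G2; case: ifPn => [|/negP xN]; first by rewrite leey.
  by have /gf/andP[] : ~ N x by move=> /mem_set.
apply: (le_trans v1); rewrite i1; apply: le_integral_nonmeasurable => // x.
rewrite /G1 patchE; case: ifPn => // /set_mem /gf /andP[]//.
Qed.

End nonmeasurable_integrand.

(** * Sampling a path at a random time *)

Section grid_from_above.
Context (R : realType).
Implicit Types (x : R) (n : nat).

(** For [x >= 0], the first multiple of [1 / (n + 1)] strictly above [x]. Strictness makes the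
    approximation come from the right even at grid points, as limits along [x^'+] require. *)
Definition grid_above n x : R := (Num.truncn (x * n.+1%:R)).+1%:R / n.+1%:R.

Lemma grid_above_gt n x : x < grid_above n x.
Proof. by rewrite /grid_above ltr_pdivlMr// truncnS_gt. Qed.

Lemma grid_above_le n x : 0 <= x -> grid_above n x <= x + n.+1%:R^-1.
Proof.
move=> x0; rewrite /grid_above ler_pdivrMr// mulrDl mulVf ?pnatr_eq0//.
by rewrite -natr1 lerD2r truncn_le mulr_ge0.
Qed.

Lemma cvg_grid_above x : 0 <= x -> grid_above n x @[n --> \oo] --> x.
Proof.
move=> x0; apply: (@squeeze_cvgr _ _ _ _ (cst x) (fun n => x + n.+1%:R^-1)).
- by near=> n; rewrite /= grid_above_le// ltW// grid_above_gt.
- exact: cvg_cst.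
- rewrite -[X in _ --> X]addr0; apply: cvgD; first exact: cvg_cst.
  exact: cvg_harmonic.
Unshelve. all: by end_near. Qed.

Lemma grid_above_cvg_right (f : R -> R) x s : 0 <= x -> 0 <= s ->
  f y @[y --> (x + s)^'+] --> f (x + s) ->
  f (grid_above n x + s) @[n --> \oo] --> f (x + s).
Proof.
move=> x0 s0 /cvg_at_rightP/(_ (fun n => grid_above n x + s)); apply; split.
  by move=> n; rewrite ltrD2r grid_above_gt.
by apply: cvgD; [exact: cvg_grid_above|exact: cvg_cst].
Qed.

End grid_from_above.

Section random_time.
Context d (T : measurableType d) (R : realType).
Variables (K : R -> T -> R) (sigma : T -> R).
Hypotheses (mK : forall s, 0 <= s -> measurable_fun setT (K s)).
Hypotheses (msigma : measurable_fun setT sigma) (sigma0 : forall w, 0 <= sigma w).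

Lemma measurable_truncn_eq n k :
  measurable [set w | Num.truncn (sigma w * n.+1%:R) = k].
Proof.
rewrite (_ : [set _ | _] = (fun w => sigma w * n.+1%:R) @^-1` `[k%:R, k.+1%:R[).
  rewrite -[X in measurable X]setTI; apply: measurable_funM => //.
apply/seteqP; split => w /=; rewrite in_itv/=.
  by move=> <-; rewrite truncn_itv// mulr_ge0.
by move=> /truncn_def.
Qed.

(** On each of the countably many events where the rounded time is a given grid point, the sampled
    value is that of a fixed time; right continuity passes to the limit. *)
Lemma measurable_random_time :
  (forall w, K x w @[x --> (sigma w)^'+] --> K (sigma w) w) ->
  measurable_fun setT (fun w => K (sigma w) w).
Proof.
move=> rc; apply: (@measurable_fun_cvg _ _ _ _ (fun n w => K (grid_above n (sigma w)) w)).
  move=> n _ B mB; rewrite setTI.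
  rewrite (_ : _ @^-1` _ = \bigcup_k ([set w | Num.truncn (sigma w * n.+1%:R) = k]
      `&` K (k.+1%:R / n.+1%:R) @^-1` B)).
    apply: bigcup_measurable => k _; apply: measurableI.
      exact: measurable_truncn_eq.
    by rewrite -[X in measurable X]setTI; apply: mK.
  apply/seteqP; split => w /=.
    by exists (Num.truncn (sigma w * n.+1%:R)).
  by move=> [k _ [<-]].
move=> w _; have /cvg_at_rightP/(_ (fun n => grid_above n (sigma w))) := rc w.
by apply; split; [move=> n; exact: grid_above_gt|exact: cvg_grid_above].
Qed.

End random_time.

(** Sub-sigma-algebras become measurable types through [g_sigma_algebraType]. Generation adds
    nothing to a family that is already a sigma-algebra, so membership and measurability can be
    exchanged. *)
Lemma measurable_g_sigma_algebraE (T : pointedType) (S : set (set T)) :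
  sigma_algebra setT S ->
  @measurable _ (g_sigma_algebraType S) = S.
Proof. by move=> hS; rewrite measurable_g_measurableTypeE. Qed.

Section sigma_algebra_closure.
Context (T : pointedType) (S : set (set T)).
Hypothesis hS : sigma_algebra setT S.

Lemma sigma_algebra_setT : S setT.
Proof. by rewrite -(measurable_g_sigma_algebraE hS); exact: measurableT. Qed.

Lemma sigma_algebra_setC A : S A -> S (~` A).
Proof. by rewrite -(measurable_g_sigma_algebraE hS); exact: measurableC. Qed.

Lemma sigma_algebra_setI A B : S A -> S B -> S (A `&` B).
Proof. by rewrite -(measurable_g_sigma_algebraE hS); exact: measurableI. Qed.

Lemma sigma_algebra_setU A B : S A -> S B -> S (A `|` B).
Proof. by rewrite -(measurable_g_sigma_algebraE hS); exact: measurableU. Qed.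

Lemma sigma_algebra_setD A B : S A -> S B -> S (A `\` B).
Proof. by rewrite -(measurable_g_sigma_algebraE hS); exact: measurableD. Qed.

End sigma_algebra_closure.

(** * Strong Markov property *)

Section shifted_stopping.
Context d (Omega : measurableType d) (R : realType).
Variables (F : R -> set (set Omega)).
Variables (sigma : Omega -> R).
Hypothesis hF : is_filtration F.
Hypothesis sigma_ge0 : forall w, 0 <= sigma w.
Hypothesis sigma_stop : forall t, 0 <= t -> F t [set w | sigma w <= t].

Let Falg t : 0 <= t -> sigma_algebra setT (F t).
Proof. exact: filtration_sigma_algebra. Qed.

Let Fmono s t A : 0 <= s -> s <= t -> F s A -> F t A.
Proof. by move=> s0 st; exact: (filtration_nondecreasing hF). Qed.

(** The history at the stopping time [sigma + s], in the usual sense of events prior to a stopping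
    time. *)
Definition shifted_sigma (s : R) : set (set Omega) :=
  [set A | measurable A /\
    forall t, 0 <= t -> F t (A `&` [set w | sigma w + s <= t])].

Lemma shifted_stop s t : 0 <= s -> 0 <= t -> F t [set w | sigma w + s <= t].
Proof.
move=> s0 t0; have [st|ts] := leP s t.
  apply: (@Fmono (t - s)); rewrite ?subr_ge0 ?gerBl//.
  rewrite (_ : [set _ | _] = [set w | sigma w <= t - s]).
    by apply: sigma_stop; rewrite subr_ge0.
  by apply/seteqP; split => w /=; rewrite lerBrDr.
rewrite (_ : [set _ | _] = set0); first by have [] := Falg t0.
by apply/seteqP; split => w //= h; have := sigma_ge0 w; lra.
Qed.

Lemma shifted_sigma_algebra s : 0 <= s -> sigma_algebra setT (shifted_sigma s).
Proof.
move=> s0; split.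
- split; first exact: measurable0.
  by move=> t t0; rewrite set0I; have [] := Falg t0.
- move=> A [mA FA]; split; first by rewrite setTD; exact: measurableC.
  move=> t t0; rewrite (_ : _ `&` _ =
      [set w | sigma w + s <= t] `\` (A `&` [set w | sigma w + s <= t])).
    by apply: (sigma_algebra_setD (Falg t0)); [exact: shifted_stop|exact: FA].
  apply/seteqP; split => w /=; first by move=> [[_ nA] h]; split => // -[].
  by move=> [h nA]; split => //; split => // Aw; apply: nA.
- move=> A hA; split; first by apply: bigcup_measurable => k _; have [] := hA k.
  move=> t t0; rewrite setI_bigcupl.
  by have [_ _] := Falg t0; apply => k; have [_] := hA k; apply.
Qed.

Lemma shifted_sigma_measurable s A : shifted_sigma s A -> measurable A.
Proof. by case. Qed.

Lemma shifted_sigma_nondecreasing s s' : 0 <= s -> s <= s' ->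
  shifted_sigma s `<=` shifted_sigma s'.
Proof.
move=> s0 ss A [mA FA]; split => // t t0.
rewrite (_ : _ `&` _ = (A `&` [set w | sigma w + s <= t]) `&`
    [set w | sigma w + s' <= t]).
  apply: (sigma_algebra_setI (Falg t0)); first exact: FA.
  by apply: shifted_stop => //; exact: le_trans ss.
apply/seteqP; split => w /=; last by move=> [[]].
by move=> [Aw h]; split => //; split => //; apply: le_trans h; rewrite lerD2l.
Qed.

(** The strict event is the union of the events [sigma + s <= q - 1 / (m + 1)], each known by time
    [q]. Strict inequalities are what the half-open cells of a grid call for. *)
Lemma shifted_sigma_lt s q A : 0 <= s -> 0 <= q -> shifted_sigma s A ->
  F q (A `&` [set w | sigma w + s < q]).
Proof.
move=> s0 q0 [mA FA].
rewrite (_ : _ `&` _ =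
    \bigcup_m (A `&` [set w | sigma w + s <= q - m.+1%:R^-1])).
  have [_ _] := Falg q0; apply => m.
  have [h|h] := leP 0 (q - m.+1%:R^-1).
    by apply: (Fmono h); [rewrite gerBl|exact: FA].
  rewrite (_ : _ `&` _ = set0); first by have [] := Falg q0.
  apply/seteqP; split => w //= -[_ h']; have := le_lt_trans h' h.
  by rewrite ltNge addr_ge0.
apply/seteqP; split => w /=.
  move=> [Aw h]; have qs : 0 < q - (sigma w + s) by rewrite subr_gt0.
  exists (Num.truncn (q - (sigma w + s))^-1) => //; split => //=.
  rewrite lerBrDr -lerBrDl -[leRHS]invrK lef_pV2 ?posrE ?invr_gt0//.
  exact/ltW/truncnS_gt.
move=> [m _ [Aw h]]; split => //; apply: (le_lt_trans h).
by rewrite ltrBlDr ltrDl.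
Qed.

Lemma measurable_minr_stop s t t' : 0 <= s -> 0 <= t -> t <= t' ->
  measurable_fun (setT : set (g_sigma_algebraType (F t')))
    (fun w => Num.min (sigma w + s) t).
Proof.
move=> s0 t0 tt; have t'0 := le_trans t0 tt.
apply: (measurability (@RGenOInfty.G R)); first exact: RGenOInfty.measurableE.
move=> _ /= [_ [r ->] <-]; rewrite setTI (measurable_g_sigma_algebraE (Falg t'0)).
have [r0|r0] := ltP r 0.
  rewrite (_ : _ @^-1` _ = setT); first exact: (sigma_algebra_setT (Falg t'0)).
  apply/seteqP; split => w //= _; rewrite in_itv/= andbT.
  by rewrite (lt_le_trans r0)// le_min t0 addr_ge0.
have [tr|rt] := leP t r.
  rewrite (_ : _ @^-1` _ = set0); first by have [] := Falg t'0.
  apply/seteqP; split => w //=; rewrite in_itv/= andbT lt_min => /andP[_].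
  by rewrite ltNge tr.
rewrite (_ : _ @^-1` _ = ~` [set w | sigma w + s <= r]).
  apply: (sigma_algebra_setC (Falg t'0)); apply: (@Fmono r) => //.
    by rewrite (le_trans (ltW rt)).
  exact: shifted_stop.
apply/seteqP; split => w /=; rewrite in_itv/= andbT lt_min rt andbT.
  by rewrite ltNge => /negP.
by move=> /negP; rewrite -ltNge.
Qed.

End shifted_stopping.

Section subordinator.
Context d (Omega : measurableType d) (R : realType).
Variables (P : probability Omega R) (F : R -> set (set Omega)).
Variables (J : R -> Omega -> R) (c : R) (nu : {measure set R -> \bar R}).
Hypothesis hF : is_filtration F.
Hypothesis hFusual : usual_conditions P F.
Hypothesis hJ : is_subordinator P F J c nu.

Local Notation eta := (laplace_exponent c nu).

Let Falg t : 0 <= t -> sigma_algebra setT (F t).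
Proof. exact: filtration_sigma_algebra. Qed.

Let Fmono s t A : 0 <= s -> s <= t -> F s A -> F t A.
Proof. by move=> s0 st; exact: (filtration_nondecreasing hF). Qed.

Lemma subordinator_preimage t B : 0 <= t -> measurable B -> F t (J t @^-1` B).
Proof.
move=> t0 mB; apply: (subord_adapted hJ t0).
by exists B => //; rewrite setTI.
Qed.

Lemma measurable_subordinator t : 0 <= t -> measurable_fun setT (J t).
Proof.
move=> t0 _ B mB; rewrite setTI.
by apply: (filtration_measurable hF t0); exact: subordinator_preimage.
Qed.

Lemma subordinator_ge0 t w : 0 <= t -> 0 <= J t w.
Proof.
by move=> t0; rewrite -(subord0 hJ w); exact: (subord_nondecreasing hJ).
Qed.

(** Independence says that the indicator of [C] and the constant [P C] have equal integrals over
    every event of the increment, so one density may replace the other; stationarity then moves the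
    increment to the origin. *)
Lemma subordinator_increment_laplace q u a C : 0 <= q -> 0 <= u -> 0 <= a ->
  F q C ->
  (\int[P]_(w in C) (expR (- (a * (J (q + u) w - J q w))))%:E =
   (expR (- (eta a * u)))%:E * P C)%E.
Proof.
move=> q0 u0 a0 FC.
have mC : measurable C by exact: (filtration_measurable hF q0).
pose X w := J (q + u) w - J q w.
have mX : measurable_fun setT X.
  by apply: measurable_funB; apply: measurable_subordinator => //; exact: addr_ge0.
pose f (x : R) := (expR (- (a * x)))%:E.
have mf : measurable_fun setT f.
  apply/measurable_EFinP; apply: measurableT_comp => //.
  by apply: measurableT_comp => //; exact: measurable_funM.
have f0 x : (0 <= f x)%E by rewrite lee_fin expR_ge0.
have PC0 : 0 <= fine (P C) by rewrite fine_ge0.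
have PCE : (fine (P C))%:E = P C by rewrite fineK// fin_num_measure.
transitivity (\int[P]_w (f (X w) * (\1_C w)%:E))%E.
  rewrite [LHS]integral_mkcond; apply: eq_integral => w _.
  by rewrite patchE indicE /f; case: ifPn; rewrite ?mule1 ?mule0.
rewrite (@integral_comp_density _ _ _ _ _ _ X (\1_C) (cst (fine (P C)))) //.
- rewrite /= ge0_integralZr//; last exact: measurableT_comp.
  rewrite PCE; congr (_ * _)%E.
  transitivity (\int[pushforward P X]_y f y)%E.
    by rewrite ge0_integral_pushforward.
  pose X0 w := J u w - J 0 w.
  have mJu : measurable_fun setT X0.
    by apply: measurable_funB; apply: measurable_subordinator.
  transitivity (\int[pushforward P X0]_y f y)%E.
    apply: eq_measure_integral => A mA _.
    exact: (subord_stationary hJ q0 u0 mA).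
  rewrite ge0_integral_pushforward//.
  rewrite -(subord_laplace hJ a0 u0) /laplace unlock.
  by apply: eq_integral => w _; rewrite /f /X0 /= (subord0 hJ) subr0.
- move=> B mB; have mXB : measurable (X @^-1` B).
    by rewrite -[X in measurable X]setTI; exact: mX.
  rewrite integral_indic// [RHS](integral_cst P mXB (fine (P C))%:E).
  rewrite PCE setIC muleC; apply: (subord_indep hJ q0 u0) => //.
  by exists B => //; rewrite setTI.
Qed.

Variable sigma : Omega -> R.
Hypothesis sigma_ge0 : forall w, 0 <= sigma w.
Hypothesis sigma_stop : forall t, 0 <= t -> F t [set w | sigma w <= t].

Local Notation G := (shifted_sigma F sigma).
Local Notation L := (fun s w => J (sigma w + s) w).

Lemma measurable_stopping : measurable_fun setT sigma.
Proof.
apply: (measurability (@RGenOInfty.G R)); first exact: RGenOInfty.measurableE.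
move=> _ /= [_ [r ->] <-]; rewrite setTI.
have [r0|r0] := ltP r 0.
  rewrite (_ : _ @^-1` _ = setT); first exact: measurableT.
  apply/seteqP; split => w //= _; rewrite in_itv/= andbT.
  exact: (lt_le_trans r0).
rewrite (_ : _ @^-1` _ = ~` [set w | sigma w <= r]).
  apply: measurableC; apply: (filtration_measurable hF r0); exact: sigma_stop.
apply/seteqP; split => w /=; rewrite in_itv/= andbT ltNge; first by move/negP.
by move=> /negP.
Qed.

Lemma subordinator_right_continuous w t : 0 <= t ->
  J x w @[x --> t^'+] --> J t w.
Proof. exact: (subord_right_continuous hJ). Qed.

Lemma measurable_after_stopping s : 0 <= s -> measurable_fun setT (L s).
Proof.
move=> s0; have h w : 0 <= sigma w + s by exact: addr_ge0.
apply: (@measurable_random_time _ _ _ J (fun w => sigma w + s)) => //.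
- by move=> t t0; exact: measurable_subordinator.
- by apply: measurable_funD => //; exact: measurable_stopping.
- by move=> w; exact: subordinator_right_continuous.
Qed.

(* Sampling the path just after the stopping time produces events of
   [F t'] for every [t' > t]; right continuity of [F] brings them back to
   [F t]. *)
Lemma after_stopping_adapted s : 0 <= s ->
  measurable_fun (setT : set (g_sigma_algebraType (G s))) (L s).
Proof.
move=> s0 _ B mB; rewrite setTI.
rewrite (measurable_g_sigma_algebraE (shifted_sigma_algebra hF sigma_ge0 sigma_stop s0)).
split.
  by rewrite -[X in measurable X]setTI; exact: (measurable_after_stopping s0).
move=> t t0; rewrite (usual_right_continuous hFusual t0) => t' /= tt'.
have t'0 : 0 <= t' by rewrite (le_trans t0)// ltW.
(* The cap at [t] makes the sampling time known at [t'], the cap at [t'] does so for each sampled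
   value. As [t < t'], the second cap is inactive just to the right of the sampling time, so right
   continuity survives; on [sigma + s <= t] both caps disappear. *)
have h : measurable_fun (setT : set (g_sigma_algebraType (F t')))
    (fun w => J (Num.min (Num.min (sigma w + s) t) t') w).
  apply: (@measurable_random_time _ (g_sigma_algebraType (F t')) _
    (fun x w => J (Num.min x t') w) (fun w => Num.min (sigma w + s) t)).
  - move=> x x0 _ A mA; rewrite setTI (measurable_g_sigma_algebraE (Falg t'0)).
    have m0 : 0 <= Num.min x t' by rewrite le_min x0.
    apply: (Fmono m0); first by rewrite ge_min lexx orbT.
    exact: subordinator_preimage.
  - exact: (measurable_minr_stop hF sigma_ge0 sigma_stop s0 t0 (ltW tt')).
  - by move=> w; rewrite le_min t0 addr_ge0.
  - move=> w; set m := Num.min (sigma w + s) t.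
    have m0 : 0 <= m by rewrite /m le_min t0 addr_ge0.
    have mt : m < t' by rewrite /m gt_min tt' orbT.
    rewrite (min_idPl (ltW mt)).
    apply: (@cvg_trans _ (J x w @[x --> m^'+])); last first.
      exact: subordinator_right_continuous.
    apply: near_eq_cvg; near=> x.
    by rewrite (min_idPl _)//; apply: ltW; near: x; exact: nbhs_right_lt.
rewrite (_ : _ `&` _ = (fun w => J (Num.min (Num.min (sigma w + s) t) t') w) @^-1` B
    `&` [set w | sigma w + s <= t]).
  apply: (sigma_algebra_setI (Falg t'0)).
    rewrite -(measurable_g_sigma_algebraE (Falg t'0)) -[X in measurable X]setTI.
    exact: h.
  by apply: (Fmono t0 (ltW tt')); exact: (shifted_stop hF sigma_ge0 sigma_stop).
by apply/seteqP; split => w /= [+ st]; rewrite (min_idPl st)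
  (min_idPl (le_trans st (ltW tt'))).
Unshelve. all: by end_near. Qed.

End subordinator.

Section strong_markov.
Context d (Omega : measurableType d) (R : realType).
Variables (P : probability Omega R) (F : R -> set (set Omega)).
Variables (J : R -> Omega -> R) (c : R) (nu : {measure set R -> \bar R}).
Hypothesis hF : is_filtration F.
Hypothesis hJ : is_subordinator P F J c nu.
Variable sigma : Omega -> R.
Hypothesis sigma_ge0 : forall w, 0 <= sigma w.
Hypothesis sigma_stop : forall t, 0 <= t -> F t [set w | sigma w <= t].

Local Notation eta := (laplace_exponent c nu).
Local Notation G := (shifted_sigma F sigma).
Local Notation L := (fun s w => J (sigma w + s) w).

Let Falg t : 0 <= t -> sigma_algebra setT (F t).
Proof. exact: filtration_sigma_algebra. Qed.

Let Fmono s t A : 0 <= s -> s <= t -> F s A -> F t A.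
Proof. by move=> s0 st; exact: (filtration_nondecreasing hF). Qed.

(** On cell [k] the time [sigma + s] lies strictly before the grid point [(k + 1) / (n + 1)], by
    which its history is already known. *)
Lemma shifted_sigma_cell s A n k : 0 <= s -> G s A ->
  F (k.+1%:R / n.+1%:R)
    (A `&` [set w | Num.truncn ((sigma w + s) * n.+1%:R) = k]).
Proof.
move=> s0 GA; have q0 m : 0 <= m%:R / n.+1%:R :> R by rewrite divr_ge0.
rewrite (_ : _ `&` _ = (A `&` [set w | sigma w + s < k.+1%:R / n.+1%:R]) `\`
    (setT `&` [set w | sigma w + s < k%:R / n.+1%:R])).
  apply: (sigma_algebra_setD (Falg (q0 _))).
    exact: (shifted_sigma_lt hF sigma_ge0).
  apply: (@Fmono (k%:R / n.+1%:R)) => //.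
    by rewrite ler_pM2r ?invr_gt0// ler_nat.
  apply: (shifted_sigma_lt hF sigma_ge0) => //.
  exact: (sigma_algebra_setT (shifted_sigma_algebra hF sigma_ge0 sigma_stop s0)).
have x0 w : 0 <= (sigma w + s) * n.+1%:R by rewrite mulr_ge0// addr_ge0.
apply/seteqP; split => w /=; rewrite !ltr_pdivlMr//.
  move=> [Aw <-]; have /andP[h1 h2] := truncn_itv (x0 w).
  by split => // -[_]; rewrite ltNge h1.
move=> [[Aw h1] h2]; split => //; apply: truncn_def; rewrite h1 andbT leNgt.
by apply/negP => h; apply: h2.
Qed.

(** Rounding [sigma + s] up to a grid reduces each cell to an increment from a deterministic time,
    independent of the part of [A] in that cell. Summation over the cells gives the same right-hand
    side for every mesh; right continuity and domination by [1] give the limit. *)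
Lemma strong_markov_event s u a A : 0 <= s -> 0 <= u -> 0 <= a -> G s A ->
  (\int[P]_(w in A) (expR (- (a * (L (s + u) w - L s w))))%:E =
   (expR (- (eta a * u)))%:E * P A)%E.
Proof.
move=> s0 u0 a0 GA; have mA := shifted_sigma_measurable GA.
have x0 w : 0 <= sigma w + s by exact: addr_ge0.
have msig : measurable_fun setT (fun w => sigma w + s).
  by apply: measurable_funD => //; exact: (measurable_stopping hF).
have mJ t : 0 <= t -> measurable_fun setT (J t).
  by move=> t0; exact: (measurable_subordinator hF hJ).
have mexp (X : Omega -> R) : measurable_fun setT X ->
    measurable_fun setT (fun w => (expR (- (a * X w)))%:E).
  move=> mX; apply/measurable_EFinP; apply: measurableT_comp => //.
  by apply: measurableT_comp => //; exact: measurable_funM.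
pose D n w := J (grid_above n (sigma w + s) + u) w - J (grid_above n (sigma w + s)) w.
have mL t : 0 <= t -> measurable_fun setT (L t).
  by move=> t0; exact: (measurable_after_stopping hF hJ sigma_ge0 sigma_stop t0).
have mgrid n : measurable_fun setT (fun w => grid_above n (sigma w + s)).
  move=> _ B mB; rewrite setTI.
  rewrite (_ : _ @^-1` _ = \bigcup_(k in [set k | B (k.+1%:R / n.+1%:R)])
      [set w | Num.truncn ((sigma w + s) * n.+1%:R) = k]).
    apply: bigcup_measurable => k _.
    exact: (measurable_truncn_eq msig x0).
  apply/seteqP; split => w /=; first by exists (Num.truncn ((sigma w + s) * n.+1%:R)).
  by move=> [k /= Bk hk]; rewrite /grid_above hk.
have g0 n w : 0 <= grid_above n (sigma w + s).
  by rewrite (le_trans (x0 w))// ltW// grid_above_gt.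
have mD n : measurable_fun setT (D n).
  apply: measurable_funB.
    apply: (@measurable_random_time _ _ _ J (fun w => grid_above n (sigma w + s) + u)) => //.
    - by apply: measurable_funD => //; exact: mgrid.
    - by move=> w; rewrite addr_ge0.
    - by move=> w; apply: (subordinator_right_continuous hJ); rewrite addr_ge0.
  apply: (@measurable_random_time _ _ _ J (fun w => grid_above n (sigma w + s))) => //.
  by move=> w; exact: (subordinator_right_continuous hJ).
have key n : (\int[P]_(w in A) (expR (- (a * D n w)))%:E =
    (expR (- (eta a * u)))%:E * P A)%E.
  pose C k := A `&` [set w | Num.truncn ((sigma w + s) * n.+1%:R) = k].
  have mC k : measurable (C k).
    by apply: measurableI => //; exact: (measurable_truncn_eq msig x0).
  have AE : A = \bigcup_k C k.
    apply/seteqP; split => w; last by move=> [k _ []].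
    by move=> Aw; exists (Num.truncn ((sigma w + s) * n.+1%:R)).
  have tC : trivIset setT C.
    by apply/trivIsetP => i j _ _ /eqP ij; apply/seteqP; split => w //= -[[_ /= h1] [_ /= h2]];
      apply: ij; rewrite -h1 -h2.
  rewrite {1}AE ge0_integral_bigcup//; last first.
    by apply: measurable_funTS; exact: mexp.
  transitivity (\sum_(0 <= k <oo) ((expR (- (eta a * u)))%:E * P (C k)))%E.
    apply: eq_eseriesr => k _.
    rewrite -(subordinator_increment_laplace hF hJ _ u0 a0 (shifted_sigma_cell n k s0 GA)).
      by apply: eq_integral => w /set_mem[_ /= <-].
    by rewrite divr_ge0.
  rewrite nneseriesZl//; congr (_ * _)%E.
  by rewrite [in RHS]AE measure_semi_bigcup// -AE.
have cv : (\int[P]_(w in A) (expR (- (a * D n w)))%:E @[n --> \oo] -->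
    \int[P]_(w in A) (expR (- (a * (L (s + u) w - L s w))))%:E)%E.
  apply: (@dominated_cvg _ _ _ _ _ mA _ _ (cst 1%E)) => //.
  - by move=> n; apply: measurable_funTS; exact: mexp.
  - move=> w _; apply: cvg_EFin; first by apply: nearW.
    apply: (@cvg_comp _ _ _ (fun n => - (a * D n w)) expR) => /=; last first.
      exact: continuous_expR.
    apply: cvgN; apply: cvgZr; apply: cvgB.
      rewrite addrA; apply: (grid_above_cvg_right (f := J^~ w)) => //.
      by apply: (subordinator_right_continuous hJ); rewrite addr_ge0.
    have /cvg_at_rightP/(_ (fun n => grid_above n (sigma w + s))) :=
      subordinator_right_continuous hJ (w := w) (x0 w).
    by apply; split; [move=> n; exact: grid_above_gt|exact: cvg_grid_above].
  - exact: (finite_measure_integrable_cst P 1).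
  - move=> n w _; rewrite gee0_abs ?lee_fin// expR_le1 oppr_le0 mulr_ge0//.
    rewrite subr_ge0; apply: (subord_nondecreasing hJ) => //.
    by rewrite lerDl.
move/cvg_lim : cv => <-//; rewrite (_ : (fun n => _) = cst ((expR (- (eta a * u)))%:E * P A)%E).
  by rewrite lim_cst.
by apply/funext => n; rewrite key.
Qed.

(** Events extend to nonnegative weights by viewing the identity as a map into [Omega] with the
    sigma-algebra [G s]; the two densities are the exponential of the increment and its constant
    mean. *)
Lemma strong_markov_laplace s u a (f : Omega -> \bar R) :
  0 <= s -> 0 <= u -> 0 <= a ->
  measurable_fun (setT : set (g_sigma_algebraType (G s))) f ->
  (forall w, 0 <= f w)%E ->
  (\int[P]_w (f w * (expR (- (a * (L (s + u) w - L s w))))%:E) =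
   \int[P]_w (f w * (expR (- (eta a * u)))%:E))%E.
Proof.
move=> s0 u0 a0 mf f0.
have GE := measurable_g_sigma_algebraE (shifted_sigma_algebra hF sigma_ge0 sigma_stop s0).
have mL t : 0 <= t -> measurable_fun setT (L t).
  by move=> t0; exact: (measurable_after_stopping hF hJ sigma_ge0 sigma_stop t0).
apply: (@integral_comp_density _ _ _ P _ (g_sigma_algebraType (G s)) id
  (fun w => expR (- (a * (L (s + u) w - L s w)))) (cst (expR (- (eta a * u)))) f) => //.
- move=> _ B; rewrite GE setTI preimage_id; exact: shifted_sigma_measurable.
- apply: measurableT_comp => //; apply: measurableT_comp => //.
  by apply: measurable_funM => //; apply: measurable_funB; apply: mL => //; exact: addr_ge0.
- by move=> w; exact: expR_ge0.
- move=> B; rewrite GE => GB; rewrite preimage_id strong_markov_event//.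
  by rewrite [RHS](integral_cst P (shifted_sigma_measurable GB) (expR (- (eta a * u)))%:E).
Qed.

End strong_markov.

(** * Auxiliary integrals, limits and measurability *)

Lemma integral_expR (R : realType) (k a b : R) : a < b ->
  (\int[lebesgue_measure]_(x in `[a, b]) (k * expR (k * (x - a)))%:E =
   (expR (k * (b - a)) - 1)%:E)%E.
Proof.
move=> ab; pose f x := expR (k * (x - a)).
have df x : is_derive x (1 : R) f (k * f x).
  apply: trigger_derive; rewrite /= /GRing.scale /= /f; ring.
have cf : continuous f.
  by move=> x; apply: differentiable_continuous; apply/derivable1_diffP; exact: ex_derive.
rewrite (@continuous_FTC2 _ _ f)//.
- by rewrite /f subrr mulr0 expR0 EFinB.
- apply: continuous_subspaceT => x.
  by apply: cvgZr; exact: cf.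
- split.
  + by move=> x _; exact: ex_derive.
  + by apply: cvg_at_right_filter; exact: cf.
  + by apply: cvg_at_left_filter; exact: cf.
- by move=> x _; rewrite derive1E derive_val.
Qed.

(** The inverse is [x] times a power of [x ^ 2], and powers are measurable; both expressions vanish
    at [0], where continuity fails. *)
Lemma measurable_invr (R : realType) : measurable_fun setT (@GRing.inv R).
Proof.
have -> : @GRing.inv R = (fun x => (x ^+ 2) `^ (-1) * x).
  apply/funext => x; rewrite powR_inv1 ?sqr_ge0//.
  have [->|x0] := eqVneq x 0; first by rewrite invr0 mulr0.
  by rewrite expr2 invfM -mulrA mulVf// mulr1.
apply: measurable_funM => //.
apply: (@measurableT_comp _ _ _ _ _ _ (@powR R ^~ (-1)) setT (fun x : R => x ^+ 2)).
  exact: measurable_powR.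
exact: exprn_measurable.
Qed.

Lemma ge0_integral_bigcup_le d (T : measurableType d) (R : realType)
    (mu : {measure set T -> \bar R}) (F : (set T)^nat) (f : T -> \bar R) c :
  nondecreasing_seq F -> (forall i, measurable (F i)) ->
  measurable_fun setT f -> (forall x, 0 <= f x)%E ->
  (forall i, \int[mu]_(x in F i) f x <= c)%E ->
  (\int[mu]_(x in \bigcup_i F i) f x <= c)%E.
Proof.
move=> ndF mF mf f0 Fc.
have cv := @ge0_nondecreasing_set_cvg_integral _ _ _ F f mu ndF mF
  (fun i => measurable_funTS mf) (fun i x _ => f0 x).
by rewrite -(cvg_lim _ cv)//; apply: lime_le; [apply/cvg_ex; eexists; exact: cv|exact: nearW].
Qed.

(** This bound and its mirror image remove the factors [exp (- a j h)] and [exp (a j h)] as the mesh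
    [h] tends to [0]. *)
Lemma lee_of_cvg1 (R : realType) (u : R^nat) (x y : \bar R) :
  u @ \oo --> (1 : R) -> x \is a fin_num -> (forall m, (u m)%:E * x <= y)%E -> (x <= y)%E.
Proof.
move=> u1 xf h; have cv : ((u m)%:E * x)%E @[m --> \oo] --> x.
  by rewrite -[X in _ --> X]mul1e; apply: cvgeZr => //; exact: cvg_EFin (nearW _ _) u1.
by rewrite -(cvg_lim _ cv)//; apply: lime_le; [apply/cvg_ex; eexists; exact: cv|exact: nearW].
Qed.

Lemma lee_of_cvg1r (R : realType) (u : R^nat) (x y : \bar R) :
  u @ \oo --> (1 : R) -> x \is a fin_num -> (forall m, y <= (u m)%:E * x)%E -> (y <= x)%E.
Proof.
move=> u1 xf h; have cv : ((u m)%:E * x)%E @[m --> \oo] --> x.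
  by rewrite -[X in _ --> X]mul1e; apply: cvgeZr => //; exact: cvg_EFin (nearW _ _) u1.
by rewrite -(cvg_lim _ cv)//; apply: lime_ge; [apply/cvg_ex; eexists; exact: cv|exact: nearW].
Qed.

(** Meant for discount rates tending to [0]: bounded integrals and pointwise convergence are enough,
    with no monotonicity to check. *)
Lemma fatou_cvg_le d (T : measurableType d) (R : realType)
    (mu : {measure set T -> \bar R}) (D : set T) (f : (T -> \bar R)^nat)
    (g : T -> \bar R) c :
  measurable D -> (forall n, measurable_fun D (f n)) ->
  (forall n x, D x -> 0 <= f n x)%E ->
  (forall x, D x -> f n x @[n --> \oo] --> g x) ->
  (forall n, \int[mu]_(x in D) f n x <= c)%E ->
  (\int[mu]_(x in D) g x <= c)%E.
Proof.
move=> mD mf f0 fg fc.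
have -> : (\int[mu]_(x in D) g x = \int[mu]_(x in D) limn_einf (f^~ x))%E.
  by apply: eq_integral => x /set_mem Dx; have [-> _] := cvg_limn_einf_sup (fg x Dx).
apply: (le_trans (fatou mu mD mf f0)); rewrite limn_einf_lim.
apply: lime_le; first exact: is_cvg_einfs.
by apply: nearW => n; apply: (le_trans _ (fc n)); apply: ereal_inf_lbound; exists n => //=.
Qed.

Section sub_sigma_algebra.
Context (T : pointedType).

Lemma measurable_fun_sub_sigma d' (U : measurableType d') (S1 S2 : set (set T))
    (f : T -> U) :
  sigma_algebra setT S1 -> sigma_algebra setT S2 -> S1 `<=` S2 ->
  measurable_fun (setT : set (g_sigma_algebraType S1)) f ->
  measurable_fun (setT : set (g_sigma_algebraType S2)) f.
Proof.
move=> h1 h2 S12 mf _ B mB.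
have := mf measurableT B mB; rewrite !setTI.
by rewrite (measurable_g_sigma_algebraE h1) (measurable_g_sigma_algebraE h2); exact: S12.
Qed.

End sub_sigma_algebra.

Lemma measurable_fun_from_sub_sigma d d' (T : measurableType d)
    (U : measurableType d') (S : set (set T)) (f : T -> U) :
  sigma_algebra setT S -> S `<=` measurable ->
  measurable_fun (setT : set (g_sigma_algebraType S)) f ->
  measurable_fun setT f.
Proof.
move=> hS Sm mf _ B mB; have := mf measurableT B mB.
by rewrite !setTI (measurable_g_sigma_algebraE hS); exact: Sm.
Qed.

(** * Busy period *)

Section workload.
Context d (Omega : measurableType d) (R : realType).
Variables (P : probability Omega R) (G : R -> set (set Omega)).
Variables (L : R -> Omega -> R) (rate : Omega -> R) (eta : R -> R).
Hypothesis G_sigma : forall s, 0 <= s -> sigma_algebra setT (G s).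
Hypothesis G_measurable : forall s, G s `<=` measurable.
Hypothesis G_nondecreasing : forall s t, 0 <= s -> s <= t -> G s `<=` G t.
Hypothesis rate_G : measurable_fun (setT : set (g_sigma_algebraType (G 0))) rate.
Hypothesis L_G : forall s, 0 <= s ->
  measurable_fun (setT : set (g_sigma_algebraType (G s))) (L s).
Hypothesis L_joint :
  measurable_fun setT (fun z : Omega * R => L (Num.max 0 z.2) z.1).
Hypothesis L_ge0 : forall w, 0 <= L 0 w.
Hypothesis L_nondecreasing : forall w s t, 0 <= s -> s <= t -> L s w <= L t w.
Hypothesis L_markov : forall s u a (f : Omega -> \bar R),
  0 <= s -> 0 <= u -> 0 <= a ->
  measurable_fun (setT : set (g_sigma_algebraType (G s))) f ->
  (forall w, 0 <= f w)%E ->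
  (\int[P]_w (f w * (expR (- (a * (L (s + u) w - L s w))))%:E) =
   \int[P]_w (f w * (expR (- (eta a * u)))%:E))%E.

Local Notation Gfun s := (measurable_fun (setT : set (g_sigma_algebraType (G s)))).
Local Notation Q := (P \x lebesgue_measure)%E.

Definition workload s w := L s w - rate w * s.
(** Time is clipped at [0] inside [L], whose paths are controlled only on nonnegative times; this
    gives a function jointly measurable on all of [Omega * R]. *)
Definition discount a (z : Omega * R) : R :=
  expR (- (a * (L (Num.max 0 z.2) z.1 - rate z.1 * z.2))).
Definition phi a w := a * rate w - eta a.

Lemma discountE a s w : 0 <= s -> discount a (w, s) = expR (- (a * workload s w)).
Proof. by move=> s0; rewrite /discount /workload (max_idPr s0). Qed.

Lemma Gfun_measurable s (f : Omega -> R) : 0 <= s -> Gfun s f -> measurable_fun setT f.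
Proof.
by move=> s0; apply: measurable_fun_from_sub_sigma; [exact: G_sigma|exact: G_measurable].
Qed.

Lemma Gfun_le s t (f : Omega -> R) : 0 <= s -> s <= t -> Gfun s f -> Gfun t f.
Proof.
move=> s0 st; apply: measurable_fun_sub_sigma.
- exact: G_sigma.
- by apply: G_sigma; exact: le_trans st.
- exact: G_nondecreasing.
Qed.

Lemma rate_Gs s : 0 <= s -> Gfun s rate.
Proof. by move=> s0; exact: (Gfun_le (lexx 0)). Qed.

Lemma measurable_rate : measurable_fun setT rate.
Proof. exact: (Gfun_measurable (lexx 0)). Qed.

Lemma workload_G s : 0 <= s -> Gfun s (workload s).
Proof.
move=> s0; apply: measurable_funB; first exact: L_G.
by apply: measurable_funM => //; exact: rate_Gs.
Qed.

Lemma phi_G a s : 0 <= s -> Gfun s (phi a).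
Proof.
move=> s0; apply: measurable_funB => //.
by apply: measurable_funM => //; exact: rate_Gs.
Qed.

Lemma expR_workload_G a s : 0 <= s -> Gfun s (fun w => expR (- (a * workload s w))).
Proof.
move=> s0; apply: measurableT_comp => //; apply: measurableT_comp => //.
by apply: measurable_funM => //; exact: workload_G.
Qed.

Lemma invr_phi_G a s : 0 <= s -> Gfun s (fun w => (phi a w)^-1).
Proof. by move=> s0; apply: (measurableT_comp (@measurable_invr R)); exact: phi_G. Qed.

Lemma measurable_discount a : measurable_fun setT (discount a).
Proof.
apply: measurableT_comp => //; apply: measurableT_comp => //.
apply: measurable_funM => //; apply: measurable_funB => //.
by apply: measurable_funM => //; apply: measurableT_comp => //; exact: measurable_rate.
Qed.

Lemma workload_step a s u (f : Omega -> R) (A : set Omega) :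
  0 <= s -> 0 <= u -> 0 <= a -> G s A -> Gfun s f -> (forall w, A w -> 0 <= f w) ->
  (\int[P]_(w in A) (f w * expR (- (a * workload (s + u) w)))%:E =
   \int[P]_(w in A) (f w * expR (- (a * workload s w)) * expR (phi a w * u))%:E)%E.
Proof.
move=> s0 u0 a0 GA mf f0.
(* [g] collects every factor known at [s], including the whole drift up to [s + u]; what is left is
   the exponential of the increment of [L], to which the Markov property applies. *)
pose g w := \1_A w * (f w * expR (- (a * L s w)) * expR (a * (rate w * (s + u)))).
have mexp (k : R) (X : Omega -> R) : Gfun s X -> Gfun s (fun w => expR (k * X w)).
  by move=> mX; apply: measurableT_comp => //; exact: measurable_funM.
have mg : Gfun s g.
  apply: measurable_funM.
    by apply: measurable_indic; rewrite (measurable_g_sigma_algebraE (G_sigma s0)).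
  apply: measurable_funM.
    apply: measurable_funM => //.
    under eq_fun do rewrite -mulNr.
    by apply: mexp; exact: L_G.
  by apply: mexp; apply: measurable_funM => //; exact: rate_Gs.
have g0 w : (0 <= (g w)%:E)%E.
  rewrite lee_fin /g indicE; case: (boolP (w \in A)) => [/set_mem Aw|_]; last by rewrite mul0r.
  by rewrite mul1r !mulr_ge0 ?expR_ge0// f0.
have := L_markov s0 u0 a0 (f := EFin \o g).
have mEg : Gfun s (EFin \o g) by exact/measurable_EFinP.
move=> /(_ mEg g0) H.
transitivity (\int[P]_w ((EFin \o g) w * (expR (- (a * (L (s + u) w - L s w))))%:E))%E.
  rewrite [LHS]integral_mkcond.
  apply: eq_integral => w _; rewrite patchE /= /g indicE -EFinM.
  case: ifPn => _; last by rewrite !mul0r.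
  rewrite mul1r -!mulrA -!expRD /workload; congr (_ * expR _)%:E; ring.
rewrite H [RHS]integral_mkcond; apply: eq_integral => w _; rewrite patchE /= /g indicE -EFinM.
case: ifPn => _; last by rewrite !mul0r.
rewrite mul1r -!mulrA -!expRD /workload /phi; congr (_ * expR _)%:E; ring.
Qed.

(* The exponential discount grows in conditional mean like
   [expR (phi * r)], so its time integral is an increment divided by [phi]. *)
Lemma workload_slab a s h (A : set Omega) :
  0 <= s -> 0 < h -> 0 <= a -> G s A -> (forall w, A w -> 0 < phi a w) ->
  (\int[Q]_(z in A `*` `[s, (s + h)%R[) (discount a z)%:E +
   \int[P]_(w in A) ((phi a w)^-1 * expR (- (a * workload s w)))%:E =
   \int[P]_(w in A) ((phi a w)^-1 * expR (- (a * workload (s + h) w)))%:E)%E.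
Proof.
move=> s0 h0 a0 GA phi0; have mA := G_measurable GA.
have mI : measurable (`[s, (s + h)%R[%classic : set R) by exact: measurable_itv.
have sh : s < s + h by rewrite ltrDl.
have mE b t : 0 <= t -> measurable_fun setT (fun w => expR (- (b * workload t w))).
  by move=> t0; exact: (Gfun_measurable t0 (expR_workload_G _ t0)).
have mphi : measurable_fun setT (phi a) by exact: (Gfun_measurable s0 (phi_G _ s0)).
have mphiV : measurable_fun setT (fun w => (phi a w)^-1).
  by apply: (measurableT_comp (@measurable_invr R)).
have step1 : (\int[Q]_(z in A `*` `[s, (s + h)%R[) (discount a z)%:E =
    \int[P]_(w in A) (expR (- (a * workload s w)) * (phi a w)^-1 * (expR (phi a w * h) - 1))%:E)%E.
  (* Time outside: at each fixed [r] the expectation is reached by a Markov step of length [r - s]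
     from [s]. *)
  transitivity (\int[lebesgue_measure]_(r in `[s, (s + h)%R[)
      \int[P]_(w in A) (discount a (w, r))%:E)%E.
    rewrite integral_mkcond fubini_tonelli2; last 2 first.
    - apply/(measurable_restrictT _ _).1; first exact: measurableX.
      by apply: measurable_funTS; apply/measurable_EFinP; exact: measurable_discount.
    - by move=> z; apply: erestrict_ge0 => ? _; rewrite lee_fin expR_ge0.
    rewrite [RHS]integral_mkcond; apply: eq_integral => r _.
    rewrite /fubini_G patchE; case: ifPn => rI.
      rewrite [RHS]integral_mkcond; apply: eq_integral => w _.
      by rewrite !patchE in_setX rI andbT.
    by apply: integral0_eq => w _; rewrite patchE in_setX (negbTE rI) andbF.
  transitivity (\int[lebesgue_measure]_(r in `[s, (s + h)%R[)
      \int[P]_(w in A) (expR (- (a * workload s w)) * expR (phi a w * (r - s)))%:E)%E.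
    apply: eq_integral => r; rewrite inE/= in_itv/= => /andP[sr rh].
    transitivity (\int[P]_(w in A) (1 * expR (- (a * workload (s + (r - s)) w)))%:E)%E.
      apply: eq_integral => w _; rewrite discountE ?(le_trans s0)//.
      by rewrite mul1r addrC subrK.
    rewrite (@workload_step a s (r - s) (cst 1))//; last by rewrite subr_ge0.
    by apply: eq_integral => w _; rewrite mul1r.
  pose Z (z : Omega * R) :=
    (((fun z => (expR (- (a * workload s z.1)) * expR (phi a z.1 * (z.2 - s)))%:E)
      : Omega * R -> \bar R) \_ (A `*` `[s, (s + h)%R[)) z.
  have mZ : measurable_fun setT Z.
    apply/(measurable_restrictT _ _).1; first exact: measurableX.
    apply: measurable_funTS; apply/measurable_EFinP; apply: measurable_funM.
      by apply: (measurableT_comp (mE a s s0)).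
    apply: measurableT_comp => //; apply: measurable_funM.
      exact: (measurableT_comp mphi).
    exact: measurable_funB.
  have Z0 z : (0 <= Z z)%E.
    by apply: erestrict_ge0 => ? _; rewrite lee_fin mulr_ge0// expR_ge0.
  transitivity (\int[lebesgue_measure]_r \int[P]_w Z (w, r))%E.
    rewrite [LHS]integral_mkcond; apply: eq_integral => r _.
    rewrite patchE; case: ifPn => rI.
      rewrite [LHS]integral_mkcond; apply: eq_integral => w _.
      by rewrite /Z !patchE in_setX rI andbT.
    by apply/esym/integral0_eq => w _; rewrite /Z patchE in_setX (negbTE rI) andbF.
  (* Time inside again: for a fixed outcome only an explicit exponential in [r] remains to be
     integrated. *)
  rewrite -(fubini_tonelli (m1 := P) (m2 := lebesgue_measure) Z mZ Z0).
  rewrite [RHS]integral_mkcond; apply: eq_integral => w _.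
  rewrite patchE; case: ifPn => wA; last first.
    by apply: integral0_eq => r _; rewrite /Z patchE in_setX (negbTE wA).
  have ph := phi0 w (set_mem wA).
  transitivity (\int[lebesgue_measure]_(r in `[s, (s + h)%R[)
    ((expR (- (a * workload s w)) * (phi a w)^-1)%:E * (phi a w * expR (phi a w * (r - s)))%:E))%E.
    rewrite [RHS]integral_mkcond; apply: eq_integral => r _.
    rewrite /Z !patchE in_setX wA/=; case: ifPn => // _.
    by rewrite -EFinM; congr EFin; field; rewrite gt_eqF.
  have mf : measurable_fun setT (fun r : R => phi a w * expR (phi a w * (r - s))).
    apply: measurable_funM => //; apply: measurableT_comp => //.
    by apply: measurable_funM => //; exact: measurable_funB.
  rewrite ge0_integralZl_EFin//; last 3 first.
  - by move=> r _; rewrite lee_fin mulr_ge0 ?expR_ge0// ltW.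
  - by apply: measurable_funTS; exact/measurable_EFinP.
  - by rewrite mulr_ge0 ?expR_ge0// invr_ge0 ltW.
  rewrite integral_itv_bndo_bndc; last first.
    by apply: measurable_funTS; exact/measurable_EFinP.
  rewrite integral_expR// -EFinM; congr (_ * (expR (_ * _) - _))%:E; ring.
rewrite step1 (@workload_step a s h (fun w => (phi a w)^-1))//; last 3 first.
- exact: ltW.
- exact: invr_phi_G.
- by move=> w Aw; rewrite invr_ge0 ltW// phi0.
rewrite -ge0_integralD//; last 4 first.
- move=> w Aw; rewrite lee_fin !mulr_ge0 ?expR_ge0 ?invr_ge0 ?ltW ?phi0//.
  by rewrite subr_gt0 expR_gt1 mulr_gt0// phi0.
- apply: measurable_funTS; apply/measurable_EFinP; apply: measurable_funM.
    by apply: measurable_funM => //; exact: mE.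
  apply: measurable_funB => //; apply: measurableT_comp => //.
  exact: measurable_funM.
- by move=> w Aw; rewrite lee_fin mulr_ge0 ?expR_ge0// invr_ge0 ltW// phi0.
- apply: measurable_funTS; apply/measurable_EFinP; apply: measurable_funM => //.
  exact: mE.
apply: eq_integral => w _; rewrite -EFinD; congr EFin; ring.
Qed.

(** * Stopping on a grid *)

Section grid.
Variables (h : R) (th : Omega -> R).
Hypothesis h_gt0 : 0 < h.
Hypothesis th_G : Gfun 0 th.

(** With [S] the first grid index at which the workload is at most [th], this is the event
    [S > k]. *)
Definition alive (k : nat) : set Omega :=
  [set w | forall j, (j <= k)%N -> th w < workload (j%:R * h) w].

Lemma aliveS k : alive k.+1 = alive k `&` [set w | th w < workload (k.+1%:R * h) w].
Proof.
apply/seteqP; split => w; first by move=> H; split => [j jk|]; apply: H => //; exact: leqW.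
by move=> [H1 H2] j; rewrite leq_eqVlt => /predU1P[->//|]; exact: H1.
Qed.

Let kh0 (k : nat) : 0 <= k%:R * h.
Proof. by rewrite mulr_ge0// ltW. Qed.

Lemma above_threshold_G s : 0 <= s -> G s [set w | th w < workload s w].
Proof.
move=> s0; have := measurable_fun_ltr (Gfun_le (lexx 0) s0 th_G) (workload_G s0).
move=> /(_ measurableT [set true] I).
by rewrite setTI (measurable_g_sigma_algebraE (G_sigma s0)).
Qed.

Lemma alive_G k : G (k%:R * h) (alive k).
Proof.
elim: k => [|k ih].
  rewrite (_ : alive 0 = [set w | th w < workload (0%:R * h) w]).
    by apply: above_threshold_G; rewrite mul0r.
  apply/seteqP; split => w; first by move/(_ 0%N); exact.
  by move=> H j; rewrite leqn0 => /eqP ->.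
rewrite aliveS; apply: (sigma_algebra_setI (G_sigma (kh0 _))).
  by apply: (G_nondecreasing _ _ ih) => //; rewrite ler_pM2r// ler_nat.
exact: above_threshold_G.
Qed.

(** The discount at grid index [min S k]: a path alive at [k'] moves on to [k'.+1], any other keeps
    its value at [S]. *)
Fixpoint stopped_discount a k w : R :=
  if k is k'.+1 then
    if `[< alive k' w >] then expR (- (a * workload (k'.+1%:R * h) w))
    else stopped_discount a k' w
  else expR (- (a * workload 0 w)).

Lemma stopped_discount_alive a k w : alive k w ->
  stopped_discount a k w = expR (- (a * workload (k%:R * h) w)).
Proof.
case: k => [|k]; first by rewrite mul0r.
by rewrite aliveS => -[ak _] /=; rewrite asboolT.
Qed.

Lemma stopped_discount_ge0 a k w : 0 <= stopped_discount a k w.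
Proof.
by elim: k => [|k ih] /=; rewrite ?expR_ge0//; case: ifPn; rewrite ?expR_ge0.
Qed.

Lemma measurable_alive k : measurable (alive k).
Proof. exact: (G_measurable (alive_G k)). Qed.

Lemma measurable_stopped_discount a k : measurable_fun setT (stopped_discount a k).
Proof.
elim: k => [|k ih] /=.
  exact: (Gfun_measurable (lexx 0) (expR_workload_G _ (lexx 0))).
apply: measurable_fun_ifT => //.
  apply: (measurable_fun_bool true); rewrite setTI.
  rewrite (_ : _ @^-1` _ = alive k); first exact: measurable_alive.
  by apply/seteqP; split => w /=; [move=> /asboolP|move=> ?; apply/asboolP].
exact: (Gfun_measurable (kh0 _) (expR_workload_G _ (kh0 _))).
Qed.

(** The points with [s < h * min S n]: being alive at the last grid point not after [s] means
    [s < h * S]. *)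
Definition region (n : nat) : set (Omega * R) :=
  [set z | [/\ 0 <= z.2, z.2 < n%:R * h & alive (Num.truncn (z.2 / h)) z.1]].

Lemma regionS n : region n.+1 =
  region n `|` alive n `*` `[n%:R * h, n%:R * h + h[.
Proof.
apply/seteqP; split => -[w s] /=.
  move=> [s0 sn al]; have [sn'|ns] := ltP s (n%:R * h); [by left|right].
  have nh : n%:R * h + h = n.+1%:R * h by rewrite -natr1 mulrDl mul1r.
  split; last by rewrite in_itv/= ns nh.
  suff <- : Num.truncn (s / h) = n by [].
  by apply: truncn_def; rewrite ler_pdivlMr// ns ltr_pdivrMr.
move=> [[s0 sn al]|[al]].
  by split => //; apply: (lt_le_trans sn); rewrite ler_pM2r// ler_nat.
rewrite in_itv/= => /andP[ns sn].
have nh : n%:R * h + h = n.+1%:R * h by rewrite -natr1 mulrDl mul1r.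
rewrite nh in sn; split => //; first exact: le_trans ns.
suff -> : Num.truncn (s / h) = n by [].
by apply: truncn_def; rewrite ler_pdivlMr// ns ltr_pdivrMr.
Qed.

Lemma region0 : region 0 = set0.
Proof. by apply/seteqP; split => -[w s] //= -[s0]; rewrite mul0r ltNge s0. Qed.

Lemma measurable_region n : measurable (region n).
Proof.
elim: n => [|n ih]; first by rewrite region0.
rewrite regionS; apply: measurableU => //; apply: measurableX.
  exact: measurable_alive.
exact: measurable_itv.
Qed.

Lemma nondecreasing_region : nondecreasing_seq region.
Proof.
by apply/nondecreasing_seqP => n; apply/subsetPset; rewrite regionS; exact: subsetUl.
Qed.

(** Optional stopping by induction on [n]: the slab identity is applied on [alive n], which is known
    at the left end of the slab, while on its complement neither the region nor the stopped discount
    changes. *)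
Lemma stopped_identity a (B : set Omega) n :
  0 <= a -> G 0 B -> (forall w, B w -> 0 < phi a w) ->
  (\int[Q]_(z in region n `&` B `*` setT) (discount a z)%:E +
   \int[P]_(w in B) ((phi a w)^-1 * expR (- (a * workload 0 w)))%:E =
   \int[P]_(w in B) ((phi a w)^-1 * stopped_discount a n w)%:E)%E.
Proof.
move=> a0 GB phi0; have mB := G_measurable GB.
have mphiV : measurable_fun setT (fun w => (phi a w)^-1).
  exact: (Gfun_measurable (lexx 0) (invr_phi_G a (lexx 0))).
have mBT : measurable (B `*` (setT : set R)) by exact: measurableX.
have mF n' : measurable_fun setT (fun w => ((phi a w)^-1 * stopped_discount a n' w)%:E).
  apply/measurable_EFinP; apply: measurable_funM => //.
  exact: measurable_stopped_discount.
have F0 n' w : B w -> (0 <= ((phi a w)^-1 * stopped_discount a n' w)%:E)%E.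
  by move=> Bw; rewrite lee_fin mulr_ge0 ?stopped_discount_ge0// invr_ge0 ltW// phi0.
have splitB n' m : (\int[P]_(w in B) ((phi a w)^-1 * stopped_discount a n' w)%:E =
    \int[P]_(w in alive m `&` B) ((phi a w)^-1 * stopped_discount a n' w)%:E +
    \int[P]_(w in B `\` alive m) ((phi a w)^-1 * stopped_discount a n' w)%:E)%E.
  have mal := measurable_alive m.
  have BE : B = (alive m `&` B) `|` (B `\` alive m) by rewrite setIC setUIDK.
  rewrite {1}BE ge0_integral_setU//.
  - exact: measurableI.
  - exact: measurableD.
  - exact: measurable_funTS.
  - by move=> w; rewrite -BE; exact: F0.
  - by apply/disj_set2P; apply/seteqP; split => w //= -[[]] ? _ [].
elim: n => [|n ih].
  by rewrite region0 set0I integral_set0 add0e.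
have mal := measurable_alive n.
have GAB : G (n%:R * h) (alive n `&` B).
  apply: (sigma_algebra_setI (G_sigma (kh0 _))); first exact: alive_G.
  exact: (G_nondecreasing (lexx 0) (kh0 _) GB).
have phi0' w : (alive n `&` B) w -> 0 < phi a w by move=> [_]; exact: phi0.
have sl := workload_slab (kh0 n) h_gt0 a0 GAB phi0'.
have nh : n%:R * h + h = n.+1%:R * h by rewrite -natr1 mulrDl mul1r.
rewrite (splitB n.+1 n).
have -> : (\int[P]_(w in alive n `&` B) ((phi a w)^-1 * stopped_discount a n.+1 w)%:E =
  \int[P]_(w in alive n `&` B) ((phi a w)^-1 * expR (- (a * workload (n%:R * h + h) w)))%:E)%E.
  by apply: eq_integral => w /set_mem[al _] /=; rewrite asboolT// nh.
have -> : (\int[P]_(w in B `\` alive n) ((phi a w)^-1 * stopped_discount a n.+1 w)%:E =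
  \int[P]_(w in B `\` alive n) ((phi a w)^-1 * stopped_discount a n w)%:E)%E.
  by apply: eq_integral => w /set_mem[_ al] /=; rewrite asboolF.
rewrite -sl -addeA.
have -> : (\int[P]_(w in alive n `&` B) ((phi a w)^-1 * expR (- (a * workload (n%:R * h) w)))%:E =
  \int[P]_(w in alive n `&` B) ((phi a w)^-1 * stopped_discount a n w)%:E)%E.
  by apply: eq_integral => w /set_mem[al _]; rewrite stopped_discount_alive.
rewrite -(splitB n n) -ih regionS setIUl ge0_integral_setU//; last 5 first.
- by apply: measurableI => //; exact: measurable_region.
- by apply: measurableI => //; apply: measurableX => //; exact: measurable_itv.
- by apply: measurable_funTS; apply/measurable_EFinP; exact: measurable_discount.
- by move=> z _; rewrite lee_fin expR_ge0.
- apply/disj_set2P; apply/seteqP; split => -[w s] //= -[[[_ sn _] _] [[_]]].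
  by rewrite in_itv/= leNgt sn.
rewrite -setXI setIT [in RHS]addeA; congr (_ + _)%E; exact: addeC.
Qed.

End grid.

(** The workload is positive at the grid point before the one where it is read, and one step takes
    away at most [rate * h <= j * h]. So it stops no lower than [- j * h]. *)
Lemma stopped_discount_le a h j k w : 0 < h -> 0 <= a -> 0 <= rate w -> rate w <= j ->
  stopped_discount h (cst 0) a k w <= expR (a * j * h).
Proof.
move=> h0 a0 r0 rj; have jh : 0 <= a * j * h.
  by rewrite mulr_ge0 ?(ltW h0)// mulr_ge0// (le_trans r0).
elim: k => [|k ih] /=.
  rewrite ler_expR (le_trans _ jh)// oppr_le0 mulr_ge0// /workload mulr0 subr0.
  exact: L_ge0.
case: ifPn => // /asboolP /(_ k (leqnn _)) /= wk.
rewrite ler_expR -mulrA -mulrN ler_wpM2l//.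
have k0 : 0 <= k%:R * h by rewrite mulr_ge0// ltW.
have kk : k%:R * h <= k.+1%:R * h by rewrite ler_pM2r// ler_nat.
have := L_nondecreasing w k0 kk; move: wk; rewrite /workload -natr1 mulrDl mul1r mulrDr.
have : rate w * h <= j * h by rewrite ler_pM2r.
lra.
Qed.

(** A path that is no longer alive was stopped at a workload of at most the threshold
    [rate * h <= j * h]. *)
Lemma stopped_discount_ge a h j k w : 0 < h -> 0 <= a -> rate w <= j ->
  ~ alive h (fun w => rate w * h) k w ->
  expR (- (a * j * h)) <= stopped_discount h (fun w => rate w * h) a k w.
Proof.
move=> h0 a0 rj; have rjh : rate w * h <= j * h by rewrite ler_pM2r.
elim: k => [|k ih] /=.
  move=> al; rewrite ler_expR -mulrA lerN2 ler_wpM2l//.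
  rewrite leNgt; apply/negP => jw; apply: al => i; rewrite leqn0 => /eqP ->.
  by rewrite mul0r (le_lt_trans rjh).
rewrite aliveS => al; case: ifPn => [/asboolP ak|/asboolPn ak]; last exact: ih.
rewrite ler_expR -mulrA lerN2 ler_wpM2l// leNgt; apply/negP => jw; apply: al.
by split => //=; exact: le_lt_trans jw.
Qed.

(** * Pathwise enclosure of the busy period *)

Hypothesis L_right_continuous : forall w t, 0 <= t -> L x w @[x --> t^'+] --> L t w.

(* The workload has only upward jumps. *)
Lemma workload_crossing w s : 0 <= s -> 0 < L 0 w -> 0 <= rate w -> workload s w <= 0 ->
  exists u, [/\ 0 <= u, u <= s & workload u w = 0].
Proof.
move=> s0 Lw rw ws.
pose E := [set u | [/\ 0 <= u, u <= s & workload u w <= 0]].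
have Es : E s by [].
have lbE : lbound E 0 by move=> u [].
have hiE : has_inf E by split; [exists s|exists 0].
pose u0 := inf E.
have u00 : 0 <= u0 by apply: lb_le_inf; [exists s|].
have u0s : u0 <= s by apply: inf_lbound Es; exists 0.
exists u0; split => //; apply/eqP; rewrite eq_le; apply/andP; split; last first.
  rewrite leNgt; apply/negP => neg.
  have r1 : 0 < rate w + 1 by rewrite ltr_wpDl.
  have u0pos : 0 < u0.
    rewrite lt_neqAle u00 andbT; apply/negP => /eqP e0.
    by move: neg; rewrite -e0 /workload mulr0 subr0 ltNge L_ge0.
  (* Going back by [t] raises the workload by at most [rate * t], which this choice keeps below its
     deficit at [u0]; the set [E] would then contain a point before its infimum. The [+ 1] avoids a
     zero denominator when the rate vanishes. *)
  pose t := Num.min u0 (- workload u0 w / (rate w + 1)).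
  have t0 : 0 < t by rewrite /t lt_min u0pos/= divr_gt0// oppr_gt0.
  have tu : t <= u0 by rewrite /t ge_min lexx.
  have tr : t * (rate w + 1) <= - workload u0 w.
    by rewrite -ler_pdivlMr// /t ge_min lexx orbT.
  have : E (u0 - t).
    split; [by rewrite subr_ge0| |].
      by rewrite (le_trans _ u0s)// gerBl ltW.
    have h1 : 0 <= u0 - t by rewrite subr_ge0.
    have h2 : u0 - t <= u0 by rewrite gerBl ltW.
    have := L_nondecreasing w h1 h2; move: tr; rewrite /workload; nra.
  by move=> /(inf_lbound (ex_intro _ 0 lbE)); rewrite leNgt gtrBl t0.
(* If the workload were positive at [u0], right continuity would keep it positive on an interval to
   the right, away from the points of [E] that approach the infimum. *)
rewrite leNgt; apply/negP => pos.
have cv : workload x w @[x --> u0^'+] --> workload u0 w.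
  apply: cvgB; first exact: L_right_continuous.
  apply: cvgZr; apply: cvg_at_right_filter; exact: cvg_id.
have /cvgr_gt/(_ _ pos) nr := cv.
have [e /= e0 he] : exists2 e : R, 0 < e & forall x, u0 < x -> x < u0 + e -> 0 < workload x w.
  move: nr => [e /= e0 he]; exists e => // x ux xe; apply: he => //=.
  by rewrite ltr0_norm ?subr_lt0// opprB ltrBlDl.
have [x Ex xe] := inf_adherent e0 hiE.
have xu : u0 <= x by apply: inf_lbound Ex; exists 0.
case: Ex => x0 xs; rewrite leNgt => /negP; apply.
by move: xu; rewrite le_eqVlt => /predU1P[<-//|xu]; exact: he.
Qed.

Let h_ (m : nat) : R := m.+1%:R^-1.
Let h_gt0 m : 0 < h_ m. Proof. by rewrite invr_gt0. Qed.

(* These enclose the busy set [{(w, s) | s < T w}]: on a grid, the threshold [0]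
   detects emptiness late, and the threshold [rate * step], which bounds the
   decrease over one step, detects it early. *)
Definition busy_outer : set (Omega * R) :=
  \bigcap_m \bigcup_n region (h_ m) (cst 0) n.
Definition busy_inner : set (Omega * R) :=
  \bigcup_m \bigcup_n region (h_ m) (fun w => rate w * h_ m) n.

(** Pathwise form of [s < T] that avoids the infimum: it follows from [s < T] and implies [s <= T],
    so the two differ at most at the single time [T]. *)
Definition no_zero w s := forall u, 0 <= u -> u <= s -> workload u w != 0.

Lemma region_alive h th n w s : 0 < h -> 0 <= s -> alive h th n w ->
  s < n.+1%:R * h -> region h th n.+1 (w, s).
Proof.
move=> h0 s0 al sn; split => //= j jk; apply: al; rewrite (leq_trans jk)//.
by rewrite -ltnS truncn_lt_nat ?divr_ge0// ?(ltW h0)// ltr_pdivrMr.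
Qed.

(** Between grid points the workload loses at most [rate * h_ m], which is the threshold it exceeded
    at the preceding grid point. *)
Lemma region_positive m n w s u : 0 <= rate w ->
  region (h_ m) (fun w => rate w * h_ m) n (w, s) -> 0 <= u -> u <= s ->
  0 < workload u w.
Proof.
move=> rw [s0 _ al] u0 us; have h0 := h_gt0 m; simpl in s0, al.
pose i := Num.truncn (u / h_ m).
have uh0 : 0 <= u / h_ m by rewrite divr_ge0// ltW.
have ik : (i <= Num.truncn (s / h_ m))%N by apply: le_truncn; rewrite ler_pM2r// invr_gt0.
have := al _ ik; have /andP[] := truncn_itv uh0.
rewrite -/i ler_pdivlMr// ltr_pdivrMr// => iu ui.
have ih0 : 0 <= i%:R * h_ m by rewrite mulr_ge0// ltW.
have := L_nondecreasing w ih0 iu.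
rewrite -natr1 mulrDl mul1r in ui.
have : rate w * u <= rate w * (i%:R * h_ m + h_ m) by rewrite ler_wpM2l// ltW.
by rewrite /workload; lra.
Qed.

Lemma busy_inner_no_zero w s : 0 <= rate w -> busy_inner (w, s) -> no_zero w s.
Proof.
move=> rw [m _ [n _ reg]] u u0 us.
by rewrite gt_eqF// (region_positive rw reg).
Qed.

Lemma no_zero_positive w s : 0 < L 0 w -> 0 <= rate w -> 0 <= s ->
  no_zero w s -> 0 < workload s w.
Proof.
move=> Lw rw s0 nz; rewrite ltNge; apply/negP => /(workload_crossing s0 Lw rw).
by move=> [u [u0 us /eqP]]; apply/negP; exact: nz.
Qed.

Lemma no_zero_busy_outer w s : 0 < L 0 w -> 0 <= rate w -> 0 <= s ->
  no_zero w s -> busy_outer (w, s).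
Proof.
move=> Lw rw s0 nz m _; have h0 := h_gt0 m.
have sh0 : 0 <= s / h_ m by rewrite divr_ge0// ltW.
exists (Num.truncn (s / h_ m)).+1 => //; split => //=.
  by rewrite -ltr_pdivrMr// truncnS_gt.
move=> j jk; apply: no_zero_positive => //.
  by rewrite mulr_ge0// ltW.
move=> u u0 uj; apply: nz => //; apply: (le_trans uj).
rewrite -ler_pdivlMr// (@le_trans _ _ (Num.truncn (s / h_ m))%:R) ?ler_nat//.
by rewrite truncn_le.
Qed.

Lemma measurable_busy_outer : measurable busy_outer.
Proof.
apply: bigcapT_measurable => m; apply: bigcup_measurable => n _.
by apply: measurable_region => //; exact: measurable_cst.
Qed.

Let th_dn m : Gfun 0 (fun w => rate w * h_ m).
Proof. exact: measurable_funM. Qed.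

Lemma measurable_busy_inner : measurable busy_inner.
Proof.
apply: bigcup_measurable => m _; apply: bigcup_measurable => n _.
exact: measurable_region.
Qed.

(** * Upper and lower bounds for the busy period *)

Variable rho : R.
Hypothesis rho_ge0 : 0 <= rho.
Hypothesis eta_le : forall a, 0 <= a -> eta a <= rho * a.

Definition stable : set Omega := [set w | rho < rate w /\ 0 < L 0 w].
(** The first condition bounds [1 / phi] by [(j + 1) / a], hence makes it integrable; the second
    bounds the loss over a step of length [h] by [j * h]. Both concern the history at time [0] only,
    so the stopped identity applies on this event. *)
Definition stable_trunc (j : nat) : set Omega :=
  [set w | [/\ j.+1%:R^-1 <= rate w - rho, rate w <= j%:R & 0 < L 0 w]].
Definition laplace_quotient a w := (1 - expR (- (a * L 0 w))) / phi a w.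
Definition load w := L 0 w / (rate w - rho).

Lemma phi_ge a w : 0 <= a -> a * (rate w - rho) <= phi a w.
Proof. by move=> a0; have := eta_le a0; rewrite /phi; lra. Qed.

Lemma stable_truncE : stable = \bigcup_j stable_trunc j.
Proof.
apply/seteqP; split => w; last first.
  move=> [j _ [h1 _ h2]]; split => //; rewrite -subr_gt0; apply: lt_le_trans h1.
  by rewrite invr_gt0.
move=> [rw Lw]; have r0 : 0 < rate w - rho by rewrite subr_gt0.
pose x := Num.max (rate w - rho)^-1 (rate w).
exists (Num.truncn x).+1 => //; have xT : x <= (Num.truncn x).+1%:R by exact/ltW/truncnS_gt.
split => //.
  rewrite -[leRHS]invrK lef_pV2 ?posrE ?invr_gt0//.
  rewrite (@le_trans _ _ x) ?le_max ?lexx// (le_trans xT)// ler_nat//.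
by rewrite (le_trans _ xT)// le_max lexx orbT.
Qed.

Lemma nondecreasing_stable_trunc : nondecreasing_seq stable_trunc.
Proof.
move=> i j ij; apply/subsetPset => w [h1 h2 h3]; split => //.
  by apply: le_trans h1; rewrite lef_pV2 ?posrE// ler_nat.
by rewrite (le_trans h2)// ler_nat.
Qed.

Lemma stable_trunc_G j : G 0 (stable_trunc j).
Proof.
have GE := measurable_g_sigma_algebraE (G_sigma (lexx 0)).
have m1 := measurable_fun_ler (measurable_cst (j.+1%:R^-1 : R))
  (measurable_funB rate_G (measurable_cst rho)).
have m2 := measurable_fun_ler rate_G (measurable_cst (j%:R : R)).
have m3 := measurable_fun_ltr (measurable_cst (0 : R)) (L_G (lexx 0)).
have := m1 measurableT [set true] I; have := m2 measurableT [set true] I.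
have := m3 measurableT [set true] I; rewrite !setTI GE => g3 g2 g1.
rewrite (_ : stable_trunc j = [set w | j.+1%:R^-1 <= rate w - rho] `&`
   [set w | rate w <= j%:R] `&` [set w | 0 < L 0 w]).
  by apply: (sigma_algebra_setI (G_sigma (lexx 0))) => //;
    apply: (sigma_algebra_setI (G_sigma (lexx 0))).
by apply/seteqP; split => w /=; [move=> []|move=> [[]]].
Qed.

Lemma measurable_stable_trunc j : measurable (stable_trunc j).
Proof. exact: (G_measurable (stable_trunc_G j)). Qed.

Lemma measurable_stable : measurable stable.
Proof. by rewrite stable_truncE; apply: bigcup_measurable => j _; exact: measurable_stable_trunc. Qed.

Lemma phi_gt0 a w : 0 < a -> rho < rate w -> 0 < phi a w.
Proof.
move=> a0 rw; apply: lt_le_trans (phi_ge w (ltW a0)).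
by rewrite mulr_gt0// subr_gt0.
Qed.

Lemma laplace_quotient_ge0 a w : 0 < a -> rho < rate w -> 0 <= laplace_quotient a w.
Proof.
move=> a0 rw; rewrite mulr_ge0// ?invr_ge0 ?(ltW (phi_gt0 _ _))//.
by rewrite subr_ge0 expR_le1 oppr_le0 mulr_ge0// ltW.
Qed.

Lemma laplace_quotient_le a w : 0 < a -> rho < rate w -> laplace_quotient a w <= load w.
Proof.
move=> a0 rw; have r0 : 0 < rate w - rho by rewrite subr_gt0.
have ph := phi_gt0 a0 rw.
rewrite /laplace_quotient /load ler_pdivrMr// mulrAC ler_pdivlMr//.
have h1 : 1 - expR (- (a * L 0 w)) <= a * L 0 w.
  by have := expR_ge1Dx (- (a * L 0 w)); lra.
have h2 := phi_ge w (ltW a0).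
apply: (@le_trans _ _ (a * L 0 w * (rate w - rho))); first by rewrite ler_pM2r.
by rewrite mulrAC mulrC ler_wpM2l.
Qed.

Lemma measurable_laplace_quotient a : measurable_fun setT (laplace_quotient a).
Proof.
have mL0 := Gfun_measurable (lexx 0) (L_G (lexx 0)).
apply: measurable_funM; last exact: (Gfun_measurable (lexx 0) (invr_phi_G a (lexx 0))).
apply: measurable_funB => //; apply: measurableT_comp => //.
by apply: measurableT_comp => //; exact: measurable_funM.
Qed.

Lemma measurable_load : measurable_fun setT load.
Proof.
have mL0 := Gfun_measurable (lexx 0) (L_G (lexx 0)).
apply: measurable_funM => //; apply: (measurableT_comp (@measurable_invr R)).
by apply: measurable_funB => //; exact: measurable_rate.
Qed.

Lemma workload0 w : workload 0 w = L 0 w.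
Proof. by rewrite /workload mulr0 subr0. Qed.

Section truncated.
Variables (a : R) (j : nat).
Hypothesis a_gt0 : 0 < a.

Local Notation B := (stable_trunc j).
Let mB : measurable B. Proof. exact: measurable_stable_trunc. Qed.
Let BT : set (Omega * R) := B `*` setT.
Let mBT : measurable BT. Proof. exact: measurableX. Qed.

Let B_rho w : B w -> rho < rate w.
Proof. by move=> [h1 _ _]; rewrite -subr_gt0; apply: lt_le_trans h1; rewrite invr_gt0. Qed.

Let B_rate w : B w -> 0 <= rate w.
Proof. by move=> /B_rho /ltW; exact: le_trans. Qed.

Let B_phi w : B w -> 0 < phi a w.
Proof. by move=> /B_rho; exact: phi_gt0. Qed.

Let B_phiV w : B w -> (phi a w)^-1 <= j.+1%:R / a.
Proof.
move=> Bw; have [h1 _ _] := Bw.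
rewrite -[leRHS]invrK lef_pV2 ?posrE ?B_phi ?invr_gt0 ?divr_gt0//.
rewrite invf_div; apply: le_trans (phi_ge w (ltW a_gt0)).
by rewrite ler_wpM2l// ltW.
Qed.

Let mphiV : measurable_fun setT (fun w => ((phi a w)^-1)%:E).
Proof.
apply/measurable_EFinP.
exact: (Gfun_measurable (lexx 0) (invr_phi_G a (lexx 0))).
Qed.

Let mL0 : measurable_fun setT (L 0).
Proof. exact: (Gfun_measurable (lexx 0) (L_G (lexx 0))). Qed.

(** [C] is the initial term of the stopped identity and [X] is its final term once the discount at
    the stop is replaced by [1]. Their difference is the integral of the quotient, and finiteness of
    both allows them to be moved across inequalities. *)
Let X := (\int[P]_(w in B) ((phi a w)^-1)%:E)%E.
Let C := (\int[P]_(w in B) ((phi a w)^-1 * expR (- (a * workload 0 w)))%:E)%E.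

Let X_le (A : set Omega) : measurable A -> A `<=` B ->
  (\int[P]_(w in A) ((phi a w)^-1)%:E <= (j.+1%:R / a)%:E * P A)%E.
Proof.
move=> mA AB; rewrite -integral_cst//; apply: ge0_le_integral => //.
- by move=> w /AB Bw; rewrite lee_fin invr_ge0 ltW// B_phi.
- exact: measurable_funTS.
- by move=> w /AB Bw; rewrite lee_fin B_phiV.
Qed.

Let X_fin : X \is a fin_num.
Proof.
rewrite ge0_fin_numE; last first.
  by apply: integral_ge0 => w Bw; rewrite lee_fin invr_ge0 ltW// B_phi.
by apply: (le_lt_trans (X_le mB (@subset_refl _ _))); rewrite -(fineK (fin_num_measure P _ mB))
  -EFinM ltry.
Qed.

Let mC : measurable_fun setT (fun w => ((phi a w)^-1 * expR (- (a * workload 0 w)))%:E).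
Proof.
apply/measurable_EFinP; apply: measurable_funM; first exact/measurable_EFinP.
exact: (Gfun_measurable (lexx 0) (expR_workload_G _ (lexx 0))).
Qed.

Let XE : (X = \int[P]_(w in B) (laplace_quotient a w)%:E + C)%E.
Proof.
rewrite /C -ge0_integralD//.
- by apply: eq_integral => w _; rewrite -EFinD /laplace_quotient workload0; congr EFin; ring.
- by move=> w Bw; rewrite lee_fin laplace_quotient_ge0// B_rho.
- by apply: measurable_funTS; apply/measurable_EFinP; exact: measurable_laplace_quotient.
- by move=> w Bw; rewrite lee_fin mulr_ge0 ?expR_ge0// invr_ge0 ltW// B_phi.
- exact: measurable_funTS.
Qed.

Let C_fin : C \is a fin_num.
Proof.
have C0 : (0 <= C)%E.
  by apply: integral_ge0 => w Bw; rewrite lee_fin mulr_ge0 ?expR_ge0// invr_ge0 ltW// B_phi.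
rewrite ge0_fin_numE//; apply: (@le_lt_trans _ _ X); last by rewrite ltey_eq X_fin.
rewrite XE leeDr//; apply: integral_ge0 => w Bw.
by rewrite lee_fin laplace_quotient_ge0// B_rho.
Qed.

Let mdisc : measurable_fun setT (fun z => (discount a z)%:E).
Proof. by apply/measurable_EFinP; exact: measurable_discount. Qed.

Let disc0 z : (0 <= (discount a z)%:E)%E.
Proof. by rewrite lee_fin expR_ge0. Qed.

Let cvg_expR_h (k : R) : expR (k * h_ m) @[m --> \oo] --> (1 : R).
Proof.
have kh : k * h_ m @[m --> \oo] --> (0 : R).
  by rewrite -[X in _ --> X](mulr0 k); apply: cvgZr; exact: cvg_harmonic.
rewrite -(@expR0 R); apply: (cvg_comp (fun m => k * h_ m) expR kh).
exact: continuous_expR.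
Qed.

(** For each mesh the stopped identity bounds the integral plus [C] by [exp (a j h) * X], uniformly
    in the number of steps. The bound covers paths that are still alive, so termination is not at
    issue here. *)
Lemma integral_busy_outer_trunc :
  (\int[Q]_(z in busy_outer `&` BT) (discount a z)%:E <=
   \int[P]_(w in B) (laplace_quotient a w)%:E)%E.
Proof.
rewrite -(leeD2rE _ _ C_fin) -XE.
apply: (lee_of_cvg1r (cvg_expR_h (a * j%:R)) X_fin) => m.
have h0 := h_gt0 m.
have th0 : Gfun 0 (cst 0 : Omega -> R) by exact: measurable_cst.
rewrite -leeBrDr//.
have mr n : measurable (region (h_ m) (cst 0) n `&` BT).
  by apply: measurableI => //; exact: measurable_region.
pose U : set (Omega * R) := \bigcup_n (region (h_ m) (cst 0) n `&` BT).
have mU : measurable U.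
  by apply: bigcup_measurable.
have le1 : (\int[Q]_(z in busy_outer `&` BT) (discount a z)%:E <=
    \int[Q]_(z in U) (discount a z)%:E)%E.
  apply: ge0_subset_integral => //.
  - by apply: measurableI => //; exact: measurable_busy_outer.
  - exact: measurable_funTS.
  - by rewrite /U -setI_bigcupl; apply: setSI => z /(_ m I).
apply: (le_trans le1).
apply: ge0_integral_bigcup_le => //.
- move=> n n' nn; apply/subsetPset; apply: setSI.
  exact/subsetPset/(nondecreasing_region (cst 0) h0).
move=> n; rewrite leeBrDr//.
rewrite /BT (stopped_identity h0 th0 n (ltW a_gt0) (stable_trunc_G j) B_phi).
rewrite -ge0_integralZl_EFin ?expR_ge0//; last 2 first.
- by move=> w Bw; rewrite lee_fin invr_ge0 ltW// B_phi.
- exact: measurable_funTS.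
apply: ge0_le_integral => //.
- by move=> w Bw; rewrite lee_fin mulr_ge0 ?stopped_discount_ge0// invr_ge0 ltW// B_phi.
- apply: measurable_funTS; apply/measurable_EFinP; apply: measurable_funM.
    exact/measurable_EFinP.
  exact: measurable_stopped_discount.
- by apply: measurable_funTS; apply: emeasurable_funM.
- move=> w Bw; rewrite -EFinM lee_fin mulrC ler_wpM2r ?invr_ge0 ?(ltW (B_phi Bw))//.
  by apply: stopped_discount_le => //; [exact: ltW|exact: B_rate|have [] := Bw].
Qed.

(** The lower bound on the stopped discount holds only for paths that have stopped; [decay] disposes
    of the others and is obtained later from the upper bound. *)
Lemma integral_busy_inner_trunc :
  (forall m, P (alive (h_ m) (fun w => rate w * h_ m) n `&` stable) @[n --> \oo] --> 0%E) ->
  (\int[P]_(w in B) (laplace_quotient a w)%:E <=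
   \int[Q]_(z in busy_inner `&` BT) (discount a z)%:E)%E.
Proof.
move=> decay; rewrite -(leeD2rE _ _ C_fin) -XE.
set I := (\int[Q]_(z in _) _)%E.
apply: (lee_of_cvg1 (cvg_expR_h (- (a * j%:R))) X_fin) => m.
have h0 := h_gt0 m; pose al := alive (h_ m) (fun w => rate w * h_ m).
have mal n : measurable (al n) by exact: measurable_alive.
(* Paths not stopped after [n] steps cost at most [(j + 1) / a], the bound on [1 / phi], times their
   probability. This error vanishes as [n] grows with the mesh fixed, the mesh being refined only
   afterwards. *)
pose k := (expR (- (a * j%:R) * h_ m) * (j.+1%:R / a))%:E.
have bnd n : ((expR (- (a * j%:R) * h_ m))%:E * X <= I + C + k * P (al n `&` stable))%E.
  have BE : B = (B `\` al n) `|` (B `&` al n) by rewrite setUC setUIDK.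
  rewrite {1}/X {1}BE ge0_integral_setU//; last 5 first.
  - exact: measurableD.
  - exact: measurableI.
  - exact: measurable_funTS.
  - by move=> w; rewrite -BE => Bw; rewrite lee_fin invr_ge0 ltW// B_phi.
  - by apply/disj_set2P; apply/seteqP; split => w //= -[[_ n1] [_]].
  rewrite ge0_muleDr; last 2 first.
  - by apply: integral_ge0 => w [Bw _]; rewrite lee_fin invr_ge0 ltW// B_phi.
  - by apply: integral_ge0 => w [Bw _]; rewrite lee_fin invr_ge0 ltW// B_phi.
  apply: leeD.
    apply: (@le_trans _ _ (\int[P]_(w in B) ((phi a w)^-1 *
        stopped_discount (h_ m) (fun w => rate w * h_ m) a n w)%:E)%E).
      rewrite -ge0_integralZl_EFin ?expR_ge0//; last 3 first.
      - exact: measurableD.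
      - by move=> w [Bw _]; rewrite lee_fin invr_ge0 ltW// B_phi.
      - exact: measurable_funTS.
      have ms : measurable_fun setT (fun w => ((phi a w)^-1 *
          stopped_discount (h_ m) (fun w => rate w * h_ m) a n w)%:E).
        apply/measurable_EFinP; apply: measurable_funM.
          exact/measurable_EFinP.
        exact: measurable_stopped_discount.
      have s0 w : B w -> (0 <= ((phi a w)^-1 *
          stopped_discount (h_ m) (fun w => rate w * h_ m) a n w)%:E)%E.
        by move=> Bw; rewrite lee_fin mulr_ge0 ?stopped_discount_ge0// invr_ge0 ltW// B_phi.
      apply: (@le_trans _ _ (\int[P]_(w in B `\` al n) ((phi a w)^-1 *
        stopped_discount (h_ m) (fun w => rate w * h_ m) a n w)%:E)%E).
        apply: ge0_le_integral => //.
        - exact: measurableD.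
        - by move=> w [Bw _]; rewrite mule_ge0// lee_fin ?expR_ge0// invr_ge0 ltW// B_phi.
        - by apply: measurable_funTS; apply: emeasurable_funM.
        - exact: measurable_funTS.
        - move=> w [Bw nal]; rewrite -EFinM lee_fin mulrC ler_wpM2l ?invr_ge0 ?(ltW (B_phi Bw))//.
          rewrite mulNr; apply: stopped_discount_ge => //; first exact: ltW.
          by have [] := Bw.
      apply: ge0_subset_integral => //; first exact: measurableD.
      exact: measurable_funTS.
    rewrite -(stopped_identity h0 (th_dn m) n (ltW a_gt0) (stable_trunc_G j) B_phi).
    rewrite leeD2r//; apply: ge0_subset_integral => //.
    - by apply: measurableI => //; exact: measurable_region.
    - by apply: measurableI => //; exact: measurable_busy_inner.
    - exact: measurable_funTS.
    - by apply: setSI => z rz; exists m => //; exists n.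
  rewrite /k EFinM -muleA lee_wpmul2l ?lee_fin ?expR_ge0//.
  apply: (le_trans (X_le _ _)); first exact: measurableI.
    exact: subIsetl.
  rewrite lee_wpmul2l ?lee_fin ?divr_ge0 ?(ltW a_gt0)//; apply: le_measure.
  - by rewrite inE; exact: measurableI.
  - by rewrite inE; apply: measurableI => //; exact: measurable_stable.
  - move=> w [Bw aw]; split => //; split; first exact: B_rho.
    by have [] := Bw.
have k0 : (k \is a fin_num) by [].
have cv : (I + C + k * P (al n `&` stable) @[n --> \oo] --> I + C + k * 0)%E.
  apply: cvgeD; last 2 first.
  - exact: cvg_cst.
  - by apply: cvgeZl => //; exact: decay.
  - by rewrite mule0 fin_num_adde_defl.
rewrite mule0 adde0 in cv; rewrite -(cvg_lim _ cv)//.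
by apply: lime_ge; [apply/cvg_ex; eexists; exact: cv|exact: nearW].
Qed.

End truncated.

Hypothesis load_fin : (\int[P]_(w in stable) (load w)%:E < +oo)%E.
Hypothesis eta_cvg : (eta (h_ m) / h_ m) @[m --> \oo] --> rho.

Let PT : set (Omega * R) := stable `*` setT.
Let mPT : measurable PT.
Proof. by apply: measurableX => //; exact: measurable_stable. Qed.

Let mouter : measurable (busy_outer `&` PT).
Proof. by apply: measurableI => //; exact: measurable_busy_outer. Qed.
Let minner : measurable (busy_inner `&` PT).
Proof. by apply: measurableI => //; exact: measurable_busy_inner. Qed.

Let mdisc a : measurable_fun setT (fun z => (discount a z)%:E).
Proof. by apply/measurable_EFinP; exact: measurable_discount. Qed.

Let mquot a : measurable_fun setT (fun w => (laplace_quotient a w)%:E).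
Proof. by apply/measurable_EFinP; exact: measurable_laplace_quotient. Qed.

Let quot_ge0 a w : 0 < a -> stable w -> (0 <= (laplace_quotient a w)%:E)%E.
Proof. by move=> a0 [rw _]; rewrite lee_fin laplace_quotient_ge0. Qed.

Let PTE : PT = \bigcup_j (stable_trunc j `*` setT).
Proof.
rewrite /PT stable_truncE; apply/seteqP; split => -[w s] /=.
  by move=> [[j _ Bw] _]; exists j.
by move=> [j _ [Bw _]]; split => //; exists j.
Qed.

Let sub_stable j : stable_trunc j `<=` stable.
Proof. by rewrite stable_truncE; exact: bigcup_sup. Qed.

Let rate_ge0 w : stable w -> 0 <= rate w.
Proof. by move=> [/ltW rw _]; exact: le_trans rw. Qed.

Lemma integral_busy_outer_le a : 0 < a ->
  (\int[Q]_(z in busy_outer `&` PT) (discount a z)%:E <=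
   \int[P]_(w in stable) (laplace_quotient a w)%:E)%E.
Proof.
move=> a0.
pose D j : set (Omega * R) := busy_outer `&` (stable_trunc j `*` setT).
have mD j : measurable (D j).
  apply: measurableI; first exact: measurable_busy_outer.
  by apply: measurableX => //; exact: measurable_stable_trunc.
have -> : busy_outer `&` PT = \bigcup_j D j by rewrite PTE setI_bigcupr.
apply: ge0_integral_bigcup_le => //.
- move=> i j ij; apply/subsetPset; apply: setIS => -[w s] [/= Bw _]; split => //.
  by have /subsetPset := nondecreasing_stable_trunc ij; apply.
- exact: mdisc.
- by move=> z; rewrite lee_fin expR_ge0.
move=> j; apply: (le_trans (integral_busy_outer_trunc j a0)).
apply: ge0_subset_integral => //.
- exact: measurable_stable_trunc.
- exact: measurable_stable.
- exact: measurable_funTS.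
- by move=> w; exact: quot_ge0.
Qed.

Let cvg_expR_h0 (k : R) : expR (- (h_ m * k)) @[m --> \oo] --> (1 : R).
Proof.
have kh : - (h_ m * k) @[m --> \oo] --> (0 : R).
  by rewrite -[X in _ --> X]oppr0; apply: cvgN; rewrite -[X in _ --> X](mul0r k);
    apply: cvgZl; exact: cvg_harmonic.
rewrite -(@expR0 R); apply: (cvg_comp (fun m => - (h_ m * k)) expR kh).
exact: continuous_expR.
Qed.

(** The rate [a = 1 / (m + 1)] sends the discount to [1] while the quotient stays below [load]. The
    resulting finite bound on the mean busy time is what forces termination. *)
Lemma busy_outer_measure_le : (\int[Q]_(z in busy_outer `&` PT) 1 <=
  \int[P]_(w in stable) (load w)%:E)%E.
Proof.
apply: (@fatou_cvg_le _ _ _ Q (busy_outer `&` PT)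
  (fun m z => (discount (h_ m) z)%:E) (fun _ => 1%E)) => //.
- by move=> m; apply: measurable_funTS; exact: mdisc.
- by move=> m z _; rewrite lee_fin expR_ge0.
- by move=> z _; apply: cvg_EFin; [exact: nearW|exact: cvg_expR_h0].
move=> m; apply: (le_trans (integral_busy_outer_le (h_gt0 m))).
have mp := measurable_stable; apply: ge0_le_integral => //.
- by move=> w; exact: quot_ge0.
- exact: measurable_funTS.
- by apply: measurable_funTS; apply/measurable_EFinP; exact: measurable_load.
- by move=> w [rw _]; rewrite lee_fin laplace_quotient_le.
Qed.

(** Survival through grid index [n] keeps the workload positive on [[0, (n + 1) h[]. Since the mean
    busy time is at most [W], this has probability at most [W / ((n + 1) h)]. *)
Lemma alive_decay m :
  P (alive (h_ m) (fun w => rate w * h_ m) n `&` stable) @[n --> \oo] --> 0%E.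
Proof.
have h0 := h_gt0 m; pose A n := alive (h_ m) (fun w => rate w * h_ m) n `&` stable.
have mA n : measurable (A n).
  by apply: measurableI; [exact: measurable_alive|exact: measurable_stable].
have W0 : (0 <= \int[P]_(w in stable) (load w)%:E)%E.
  by apply: integral_ge0 => w [rw Lw]; rewrite lee_fin divr_ge0// subr_ge0 ltW.
pose W := fine (\int[P]_(w in stable) (load w)%:E)%E.
have WE : (W%:E = \int[P]_(w in stable) (load w)%:E)%E.
  by rewrite fineK// ge0_fin_numE.
have bnd n : (P (A n) <= (W / h_ m * harmonic n)%:E)%E.
  pose I : set R := `[0, n.+1%:R * h_ m[%classic.
  have nh0 : 0 < n.+1%:R * h_ m by rewrite mulr_gt0.
  have mI : measurable I by exact: measurable_itv.
  have mAI : measurable (A n `*` I : set (Omega * R)) by exact: measurableX.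
  have : (\int[Q]_(z in A n `*` I) 1 <= W%:E)%E.
    rewrite WE; apply: (le_trans _ busy_outer_measure_le).
    apply: ge0_subset_integral => // -[w s] [/= [al pw]].
    rewrite /I/= in_itv/= => /andP[s0 sn]; split => //.
    have [_ Lw] := pw; apply: no_zero_busy_outer => //; first exact: rate_ge0.
    apply: busy_inner_no_zero; first exact: rate_ge0.
    by exists m => //; exists n.+1 => //; exact: region_alive.
  rewrite (integral_cst _ _ 1%E)//= mul1e product_measure1E//.
  have lI : lebesgue_measure I = (n.+1%:R * h_ m)%:E.
    by rewrite /I lebesgue_measure_itv/= lte_fin nh0 sube0.
  move=> le1; have {le1} : (P (A n) * (n.+1%:R * h_ m)%:E <= W%:E)%E by rewrite -lI; exact: le1.
  rewrite -(fineK (fin_num_measure P _ (mA n))) -EFinM !lee_fin.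
  rewrite -ler_pdivlMr// => /le_trans; apply.
  by rewrite /harmonic/= invfM -mulrA [_^-1 / _]mulrC.
apply: (@squeeze_cvge _ _ _ _ (cst 0%E) _ (fun n => (W / h_ m * harmonic n)%:E)).
- by apply: nearW => n; rewrite measure_ge0/=; exact: bnd.
- exact: cvg_cst.
- apply: cvg_EFin; first exact: nearW.
  by rewrite -[X in _ --> X](mulr0 (W / h_ m)); apply: cvgZr; exact: cvg_harmonic.
Qed.

Lemma integral_busy_inner_ge a : 0 < a ->
  (\int[P]_(w in stable) (laplace_quotient a w)%:E <=
   \int[Q]_(z in busy_inner `&` PT) (discount a z)%:E)%E.
Proof.
move=> a0.
(* The quotient is known to be nonnegative only on [stable], whereas the passage to the union asks
   for it everywhere; the positive part does not alter the integral. *)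
have -> : (\int[P]_(w in stable) (laplace_quotient a w)%:E =
    \int[P]_(w in stable) (Num.max (laplace_quotient a w) 0)%:E)%E.
  apply: eq_integral => w /set_mem pw; congr EFin.
  by rewrite (max_idPl _)// -lee_fin; exact: quot_ge0.
rewrite stable_truncE.
apply: ge0_integral_bigcup_le.
- exact: nondecreasing_stable_trunc.
- exact: measurable_stable_trunc.
- apply/measurable_EFinP; apply: measurable_maxr => //.
  exact: measurable_laplace_quotient.
- by move=> w; rewrite lee_fin le_max lexx orbT.
move=> j.
have -> : (\int[P]_(w in stable_trunc j) (Num.max (laplace_quotient a w) 0)%:E =
    \int[P]_(w in stable_trunc j) (laplace_quotient a w)%:E)%E.
  apply: eq_integral => w /set_mem /sub_stable pw; congr EFin.
  by rewrite (max_idPl _)// -lee_fin; exact: quot_ge0.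
apply: (le_trans (integral_busy_inner_trunc j a0 alive_decay)).
have mD : measurable (busy_inner `&` (stable_trunc j `*` setT)).
  apply: measurableI; first exact: measurable_busy_inner.
  by apply: measurableX => //; exact: measurable_stable_trunc.
apply: ge0_subset_integral => //.
- by apply: measurable_funTS; exact: mdisc.
- by move=> z _; rewrite lee_fin expR_ge0.
- by apply: setIS => -[w s] [/= /sub_stable].
Qed.

(** The lower side of the squeeze is [1 - exp (- x) >= x / (1 + x)] with [x = h V]; the upper side
    is the bound by [load]. *)
Lemma cvg_laplace_quotient w : stable w ->
  laplace_quotient (h_ m) w @[m --> \oo] --> load w.
Proof.
move=> [rw Lw]; have r0 : 0 < rate w - rho by rewrite subr_gt0.
apply: (@squeeze_cvgr _ _ _ _
  (fun m => L 0 w / (1 + h_ m * L 0 w) / (rate w - eta (h_ m) / h_ m)) (cst (load w))).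
- apply: nearW => m; rewrite laplace_quotient_le// andbT.
  have h0 := h_gt0 m; have ph := phi_gt0 h0 rw.
  have den : 0 < 1 + h_ m * L 0 w by rewrite ltr_wpDr// ltW// mulr_gt0.
  rewrite (_ : L 0 w / _ / _ = h_ m * L 0 w / (1 + h_ m * L 0 w) / phi (h_ m) w); last first.
    rewrite /phi; have e1 : rate w - eta (h_ m) / h_ m = (h_ m * rate w - eta (h_ m)) / h_ m.
      by rewrite mulrBl mulrAC mulfV ?gt_eqF// mul1r.
    rewrite e1; field; rewrite !gt_eqF//=.
  rewrite /laplace_quotient ler_pM2r ?invr_gt0//.
  rewrite ler_pdivrMr// mulrBl mul1r lerBrDr expRN.
  rewrite [leLHS]addrC lerD2r.
  by rewrite mulrC ler_pdivrMr ?expR_gt0// mul1r expR_ge1Dx.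
- rewrite /load -[X in X / _]divr1; apply: cvgM.
    apply: cvgZr; apply: cvgV; first by rewrite oner_neq0.
    rewrite -[X in _ --> X]addr0; apply: cvgD; first exact: cvg_cst.
    by rewrite -[X in _ --> X](mul0r (L 0 w)); apply: cvgZl; exact: cvg_harmonic.
  apply: cvgV; first by rewrite gt_eqF.
  by apply: cvgB => //; exact: cvg_cst.
- exact: cvg_cst.
Qed.

(** The workload is positive on the inner set, so the discount is at most [1] there and the lower
    bound for each [a > 0] gives one for the measure; Fatou then lets the quotient tend to
    [load]. *)
Lemma busy_inner_measure_ge : (\int[P]_(w in stable) (load w)%:E <=
  \int[Q]_(z in busy_inner `&` PT) 1)%E.
Proof.
have mp := measurable_stable.
apply: (@fatou_cvg_le _ _ _ _ _ (fun m w => (laplace_quotient (h_ m) w)%:E)) => //.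
- by move=> m; exact: measurable_funTS.
- by move=> m w; exact: quot_ge0.
- by move=> w pw; apply: cvg_EFin; [exact: nearW|exact: cvg_laplace_quotient].
move=> m; apply: (le_trans (integral_busy_inner_ge (h_gt0 m))).
apply: ge0_le_integral => //.
- by move=> z _; rewrite lee_fin expR_ge0.
- by apply: measurable_funTS; exact: mdisc.
move=> -[w s] [bi [/= pw _]]; rewrite lee_fin.
have s0 : 0 <= s by have [k _ [n _ []]] := bi.
have [_ Lw] := pw.
rewrite discountE// expR_le1 oppr_le0 mulr_ge0// ?(ltW (h_gt0 m))// ltW//.
apply: no_zero_positive => //; first exact: rate_ge0.
by apply: busy_inner_no_zero => //; exact: rate_ge0.
Qed.

Definition busy_period w : \bar R :=
  ereal_inf [set s%:E | s in [set s : R | 0 <= s /\ workload s w = 0]].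

Let busy_no_zero w s : (s%:E < busy_period w)%E -> no_zero w s.
Proof.
move=> st u u0 us; apply/negP => /eqP z.
have : (busy_period w <= u%:E)%E by apply: ereal_inf_lbound; exists u.
by move=> /(lt_le_trans st); rewrite lte_fin ltNge us.
Qed.

Let no_zero_busy w s : 0 <= s -> no_zero w s -> (s%:E <= busy_period w)%E.
Proof.
move=> s0 nz; apply: le_ereal_inf_tmp => _ [u [u0 z] <-].
rewrite lee_fin leNgt; apply/negP => /ltW us.
by have := nz u u0 us; rewrite z eqxx.
Qed.

Let busy_itv w : [set s : R | 0 <= s /\ (s%:E <= busy_period w)%E] =
  if busy_period w is r%:E then `[0, r]%classic else
  if busy_period w == +oo%E then `[0, +oo[%classic else set0.
Proof.
apply/seteqP; case: (busy_period w) => [r| |] /=; split => s //=;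
  rewrite ?in_itv/= ?andbT ?lee_fin ?leey ?leeNy_eq//; first by move=> [-> ->].
- by move=> /andP[].
- by case.
- by move=> [].
Qed.

Lemma integral_busy_period a : 0 <= a -> {ae P, forall w, stable w} ->
  (\int[P]_w \int[lebesgue_measure]_(s in [set s : R | (0 <= s)%R /\ s%:E <= busy_period w])
     (expR (- (a * workload s w)))%:E =
   \int[P]_(w in stable) (if a == 0%R then load w else laplace_quotient a w)%:E)%E.
Proof.
move=> a0 aep.
have [bo bi] : (\int[Q]_(z in busy_outer `&` PT) (discount a z)%:E <=
    \int[P]_(w in stable) (if a == 0%R then load w else laplace_quotient a w)%:E)%E /\
  (\int[P]_(w in stable) (if a == 0%R then load w else laplace_quotient a w)%:E <=
    \int[Q]_(z in busy_inner `&` PT) (discount a z)%:E)%E.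
  have [a00|an0] := eqVneq a 0; last first.
    by split; [apply: integral_busy_outer_le|apply: integral_busy_inner_ge];
      rewrite lt_neqAle eq_sym an0.
  have d1 z : (discount a z)%:E = 1%E :> \bar R by rewrite /discount a00 mul0r oppr0 expR0.
  under eq_integral do rewrite d1.
  split; first exact: busy_outer_measure_le.
  under [leRHS]eq_integral do rewrite d1.
  exact: busy_inner_measure_ge.
pose g (D : set (Omega * R)) (z : Omega * R) : \bar R :=
  (((fun z : Omega * R => (discount a z)%:E) : Omega * R -> \bar R) \_ D) z.
have mg (D : set (Omega * R)) : measurable D -> measurable_fun setT (g D).
  move=> mD; apply/(measurable_restrictT _ _).1 => //.
  by apply: measurable_funTS; exact: mdisc.
have g0 D z : (0 <= g D z)%E by apply: erestrict_ge0 => ? _; rewrite lee_fin expR_ge0.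
pose H D w := (\int[lebesgue_measure]_s g D (w, s))%E.
have mH (D : set (Omega * R)) : measurable D -> measurable_fun setT (H D).
  move=> mD; exact: (@measurable_fun_fubini_tonelli_F _ _ _ _ _ lebesgue_measure (g D) (mg D mD) (g0 D)).
have H0 D w : (0 <= H D w)%E by apply: integral_ge0.
have HE (D : set (Omega * R)) : measurable D -> (\int[Q]_(z in D) (discount a z)%:E = \int[P]_w H D w)%E.
  move=> mD; rewrite integral_mkcond.
  exact: (@fubini_tonelli1 _ _ _ _ _ P lebesgue_measure (g D) (mg D mD) (g0 D)).
apply: (@integral_sandwich _ _ _ P _ (H (busy_inner `&` PT)) (H (busy_outer `&` PT))).
- by move=> w; apply: integral_ge0 => s _; rewrite lee_fin expR_ge0.
- exact: H0.
- exact: H0.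
- exact: mH.
- exact: mH.
- apply: filterS aep => w pw; have [rw Lw] := pw; have r0 := rate_ge0 pw.
  pose D := [set s : R | 0 <= s /\ (s%:E <= busy_period w)%E].
  have mD : measurable D.
    by rewrite /D busy_itv; case: (busy_period w) => [r| |] //=; rewrite ?eqxx.
  have -> : (\int[lebesgue_measure]_(s in D) (expR (- (a * workload s w)))%:E =
      \int[lebesgue_measure]_(s in D) (discount a (w, s))%:E)%E.
    by apply: eq_integral => s /set_mem[s0 _]; rewrite discountE.
  apply/andP; split.
    rewrite [leRHS]integral_mkcond; apply: le_integral_nonmeasurable => [s|s].
      exact: g0.
    rewrite /g !patchE; case: ifPn => [/set_mem[bin _]|_]; last first.
      by case: ifPn; rewrite ?lee_fin ?expR_ge0.
    rewrite mem_set//; have s0 : 0 <= s by have [k _ [n _ []]] := bin.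
    by split => //; apply: no_zero_busy => //; exact: busy_inner_no_zero bin.
  have mdw : measurable_fun setT (fun s => (discount a (w, s))%:E).
    by apply/measurable_EFinP; exact: (measurableT_comp (measurable_discount a) (pair1_measurable w)).
  (* Removing the endpoint, a null set, turns [s <= T] into [s < T]. If [T] is infinite, [fine]
     gives [0], whose removal is equally harmless. *)
  rewrite -(@integral_setD1 _ _ (fine (busy_period w))); last 2 first.
  - exact: measurableD.
  - exact: measurable_funTS.
  rewrite [leLHS]integral_mkcond; apply: le_integral_nonmeasurable => [s|s].
    by apply: erestrict_ge0 => ? _; rewrite lee_fin expR_ge0.
  rewrite /g !patchE; case: ifPn => [/set_mem[[s0 sT] sne]|_]; last first.
    by case: ifPn; rewrite ?lee_fin ?expR_ge0.
  rewrite mem_set//; split => //; apply: no_zero_busy_outer => //.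
  apply: busy_no_zero; rewrite lt_neqAle sT andbT; apply/negP => /eqP e.
  by apply: sne => /=; rewrite -e.
- by rewrite -HE.
- by rewrite -HE.
Qed.

End workload.

(** * Compound geometric representation *)

Section independence.
Context d (Omega : measurableType d) (R : realType).
Variables (P : probability Omega R).
Context d' (T' : measurableType d').
Variables (U : Omega -> R) (X : Omega -> T') (e : nat -> Omega -> R).
Hypotheses (mU : measurable_fun setT U) (mX : measurable_fun setT X).
Hypothesis me : forall n, measurable_fun setT (e n).
Variable S : nat -> set (set Omega).
Hypothesis S0 : S 0%N = sigma_gen U.
Hypothesis S1 : S 1%N = sigma_gen X.
Hypothesis SS : forall n, S n.+2 = sigma_gen (e n).
Hypothesis hS : mutually_indep P S.
Variables (a q : R).
Hypothesis laplace_e : forall n, laplace P (e n) a = q%:E.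

Let S_measurable i A : S i A -> measurable A.
Proof.
by case: i => [|[|n]]; rewrite ?S0 ?S1 ?SS => -[B mB <-]; [apply: mU|apply: mX|apply: me].
Qed.

Definition laplace_prod k w : R := \prod_(i < k) expR (- (a * e i w)).

Lemma laplace_prod_ge0 k w : 0 <= laplace_prod k w.
Proof. by apply: prodr_ge0 => i _; exact: expR_ge0. Qed.

Lemma measurable_laplace_prod k : measurable_fun setT (laplace_prod k).
Proof.
elim: k => [|k ih].
  by rewrite (_ : laplace_prod 0 = cst 1)//; apply/funext => w; rewrite /laplace_prod big_ord0.
rewrite (_ : laplace_prod k.+1 = (fun w => laplace_prod k w * expR (- (a * e k w)))); last first.
  by apply/funext => w; rewrite /laplace_prod big_ord_recr.
apply: measurable_funM => //; apply: measurableT_comp => //.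
by apply: measurableT_comp => //; exact: measurable_funM.
Qed.

Let mbigcap (s : seq nat) (A : nat -> set Omega) :
  (forall i, i \in s -> S i (A i)) -> measurable (\bigcap_(i in [set` s]) A i).
Proof.
move=> SA; apply: fin_bigcap_measurable => // i /= /SA.
exact: S_measurable.
Qed.

(** Induction on the number of factors, with the list of events left general: testing the last
    factor against an event of [e k] adds one entry to the list, and the side condition says that
    the list avoids the variables already in the product. *)
Lemma laplace_prod_event k (s : seq nat) (A : nat -> set Omega) :
  uniq s -> (forall i, i \in s -> S i (A i)) ->
  (forall i, i \in s -> (i <= 1)%N || (k.+2 <= i)%N) ->
  (\int[P]_(w in \bigcap_(i in [set` s]) A i) (laplace_prod k w)%:E =
   \prod_(i <- s) P (A i) * (q ^+ k)%:E)%E.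
Proof.
elim: k s A => [|k ih] s A us SA sk.
  rewrite -(hS us SA) expr0 mule1.
  under eq_integral do rewrite /laplace_prod big_ord0.
  by rewrite (integral_cst P (mbigcap SA) 1%E) mul1e.
set As := \bigcap_(i in [set` s]) A i.
have mAs : measurable As by exact: mbigcap.
pose Z1 w := laplace_prod k w * \1_As w.
have finP : (\prod_(i <- s) P (A i) \is a fin_num)%E.
  by rewrite -(hS us SA); exact: fin_num_measure.
pose K : R := fine (\prod_(i <- s) P (A i))%E * q ^+ k.
have KE : (K%:E = \prod_(i <- s) P (A i) * (q ^+ k)%:E)%E by rewrite /K EFinM fineK.
have sk' i : i \in s -> (i <= 1)%N || (k.+2 <= i)%N.
  by move=> /sk/orP[->//|h]; rewrite (ltnW h) orbT.
have K0 : 0 <= K.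
  rewrite -lee_fin KE -(ih _ _ us SA sk').
  by apply: integral_ge0 => w _; rewrite lee_fin laplace_prod_ge0.
pose f (x : R) := (expR (- (a * x)))%:E.
have mf : measurable_fun setT f.
  apply/measurable_EFinP; apply: measurableT_comp => //.
  by apply: measurableT_comp => //; exact: measurable_funM.
have f0 x : (0 <= f x)%E by rewrite lee_fin expR_ge0.
transitivity (\int[P]_w (f (e k w) * (Z1 w)%:E))%E.
  rewrite [LHS]integral_mkcond; apply: eq_integral => w _.
  rewrite patchE /Z1 indicE /f -EFinM /laplace_prod big_ord_recr/=.
  by case: ifPn => _; rewrite ?mulr1 ?mulr0//; congr EFin; rewrite mulrC.
rewrite (@integral_comp_density _ _ _ P _ _ (e k) Z1 (cst K) f) //.
- rewrite /= ge0_integralZr//; last by apply: measurableT_comp.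
  have -> : (\int[P]_x f (e k x) = q%:E)%E.
    by rewrite -(laplace_e k) /laplace unlock.
  by rewrite KE muleCA -EFinM -exprS.
- by apply: measurable_funM; [exact: measurable_laplace_prod|exact: measurable_indic].
- by move=> w; rewrite mulr_ge0// ?laplace_prod_ge0// indicE.
move=> B mB.
have mB' : measurable (e k @^-1` B) by rewrite -[X in measurable X]setTI; exact: me.
rewrite [RHS](integral_cst P mB' K%:E).
(* Indices [0] and [1] belong to [U] and [X], hence [e k] has index [k + 2]. *)
pose A' i := if i == k.+2 then e k @^-1` B else A i.
have ks : k.+2 \notin s by apply/negP => /sk; rewrite ltnn.
have us' : uniq (k.+2 :: s) by rewrite /= ks.
have A's i : i \in s -> A' i = A i.
  by move=> is_; rewrite /A' ifN//; apply: contraNneq ks => <-.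
have SA' i : i \in k.+2 :: s -> S i (A' i).
  rewrite inE => /predU1P[->|is_]; last by rewrite A's//; exact: SA.
  by rewrite /A' eqxx SS; exists B => //; rewrite setTI.
have sk2 i : i \in k.+2 :: s -> (i <= 1)%N || (k.+2 <= i)%N.
  by rewrite inE => /predU1P[->|/sk']//; rewrite leqnn orbT.
have := ih _ _ us' SA' sk2.
have A'k : A' k.+2 = e k @^-1` B by rewrite /A' eqxx.
rewrite big_cons A'k.
have -> : (\prod_(i <- s) P (A' i) = \prod_(i <- s) P (A i))%E.
  by rewrite big_seq [RHS]big_seq; apply: eq_bigr => i is_; rewrite A's.
move=> H; rewrite [RHS]muleC KE muleA -H [LHS]integral_mkcond [RHS]integral_mkcond; apply: eq_integral => w _.
have E : (w \in \bigcap_(i in [set` k.+2 :: s]) A' i) = (w \in e k @^-1` B) && (w \in As).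
  apply/idP/andP.
    move=> /set_mem h; split; apply/mem_set.
      by have := h k.+2; rewrite /A' eqxx; apply => /=; rewrite inE eqxx.
    by move=> i /= is_; rewrite -(A's _ is_); apply: h; rewrite /= inE is_ orbT.
  move=> [/set_mem h1 /set_mem h2]; apply/mem_set => i /=.
  by rewrite inE => /predU1P[->|is_]; [rewrite /A' eqxx|rewrite A's//; exact: h2].
rewrite !patchE E /Z1 indicE; case: (_ \in e k @^-1` B) => //=.
by case: ifPn => _; rewrite ?mulr1 ?mulr0.
Qed.

Hypothesis q_gt0 : 0 < q.

(* Weighting by the normalized factor of [e] leaves [U] and [X] independent
   with their original laws, hence Fubini applies. *)
Lemma integral_laplace_prod n (f : R * T' -> \bar R) :
  measurable_fun setT f -> (forall z, 0 <= f z)%E ->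
  (\int[P]_w (f (U w, X w) * (laplace_prod n w)%:E) =
   (q ^+ n)%:E * \int[P]_w \int[pushforward P U]_u f (u, X w))%E.
Proof.
move=> mf f0.
have qn0 : 0 < q ^+ n by rewrite exprn_gt0.
pose Z w := laplace_prod n w / q ^+ n.
have mZ : measurable_fun setT Z by apply: measurable_funM => //; exact: measurable_laplace_prod.
have Z0 w : 0 <= Z w by rewrite divr_ge0 ?laplace_prod_ge0// ltW.
pose U' : {mfun Omega >-> R} := HB.pack U (isMeasurableFun.Build _ _ _ _ U mU).
pose X' : {mfun Omega >-> T'} := HB.pack X (isMeasurableFun.Build _ _ _ _ X mX).
pose UX w := (U w, X w).
have mUX : measurable_fun setT UX by exact: measurable_fun_pair.
pose m1 := distribution P U'; pose m2 := distribution P X'.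
have step : (\int[P]_w (f (U w, X w) * (Z w)%:E) =
    \int[P]_w \int[pushforward P U]_u f (u, X w))%E.
  transitivity (\int[pushforward (density_measure P mZ Z0) UX]_z f z)%E.
    rewrite ge0_integral_pushforward//.
    transitivity (\int[density_measure P mZ Z0]_w f (UX w))%E; last by [].
    by rewrite integral_density//; exact: measurableT_comp.
  transitivity (\int[m1 \x m2]_z f z)%E.
    apply: eq_measure_integral => A mA _; apply/esym; move: A mA.
    apply: product_measure_unique => A B mA mB.
    pose C i := if i == 0%N then U @^-1` A else X @^-1` B.
    have us : uniq [:: 0%N; 1%N] by [].
    have SC i : i \in [:: 0%N; 1%N] -> S i (C i).
      rewrite !inE => /orP[] /eqP ->; rewrite /C/= ?S0 ?S1.
        by exists A => //; rewrite setTI.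
      by exists B => //; rewrite setTI.
    have sk i : i \in [:: 0%N; 1%N] -> (i <= 1)%N || (n.+2 <= i)%N.
      by rewrite !inE => /orP[] /eqP ->.
    have := laplace_prod_event us SC sk; rewrite !big_cons big_nil mule1 /C/=.
    have -> : \bigcap_(i in [set` [:: 0%N; 1%N]]) (if i == 0%N then U @^-1` A else X @^-1` B) =
        UX @^-1` (A `*` B).
      apply/seteqP; split => w /=.
        by move=> h; split; [apply: (h 0%N)|apply: (h 1%N)].
      by move=> [h1 h2] i /=; rewrite !inE => /orP[] /eqP ->.
    move=> H; rewrite /pushforward /= /density_measure.
    have mAB : measurable (UX @^-1` (A `*` B)).
      by rewrite -[X in measurable X]setTI; apply: mUX => //; exact: measurableX.
    under eq_integral do rewrite /Z mulrC EFinM.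
    rewrite ge0_integralZl_EFin//; last 3 first.
    - by move=> w _; rewrite lee_fin laplace_prod_ge0.
    - by apply: measurable_funTS; apply/measurable_EFinP; exact: measurable_laplace_prod.
    - by rewrite invr_ge0 ltW.
    rewrite H muleC -muleA -EFinM mulfV ?gt_eqF// mule1.
    by [].
  rewrite fubini_tonelli2//.
  rewrite ge0_integral_pushforward//; last first.
    by move=> y _; apply: integral_ge0.
  exact: measurable_fun_fubini_tonelli_G.
rewrite -step -ge0_integralZl_EFin//; last 3 first.
- by move=> w _; rewrite mule_ge0// lee_fin.
- apply: emeasurable_funM; last exact/measurable_EFinP.
  by apply: measurableT_comp.
- exact: ltW.
apply: eq_integral => w _; rewrite muleCA -EFinM /Z; congr (_ * _%:E)%E.
by rewrite mulrC mulfVK// gt_eqF.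
Qed.

End independence.

Section compound_geometric.
Context d (Omega : measurableType d) (R : realType).
Variables (P : probability Omega R).
Variables (V rate U : Omega -> R) (N : Omega -> nat) (e : nat -> Omega -> R).
Hypotheses (mV : measurable_fun setT V) (mrate : measurable_fun setT rate).
Hypotheses (mU : measurable_fun setT U) (mN : measurable_fun setT N).
Hypothesis me : forall n, measurable_fun setT (e n).
Variable S : nat -> set (set Omega).
Hypothesis S0 : S 0%N = sigma_gen U.
Hypothesis S1 : S 1%N = sigma_gen (fun w => (V w, rate w, N w)).
Hypothesis SS : forall n, S n.+2 = sigma_gen (e n).
Hypothesis hS : mutually_indep P S.
Variables (a q rho : R).
Hypothesis laplace_e : forall n, laplace P (e n) a = q%:E.
Hypothesis U_uniform : forall B : set R, measurable B ->
  pushforward P U B = uniform_prob (@ltr01 R) B.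
Hypotheses (a_gt0 : 0 < a) (q_gt0 : 0 < q) (q_le1 : q <= 1) (rho_ge0 : 0 <= rho).
Hypothesis V_gt0 : {ae P, forall w, 0 < V w}.
Hypothesis rate_gt : {ae P, forall w, rho < rate w}.
Hypothesis N_geom : forall n : nat,
  is_cond_prob P [set w | N w = n] (fun w => (V w, rate w))
    (fun vr : R * R => (1 - rho / vr.2) * (rho / vr.2) ^+ n).

(** The absolute values here and in [hU] give nonnegativity everywhere and are inactive where
    [V > 0] and [R > rho]. For [v > 0], [hU v] is the Laplace transform of [U v] at [a]. *)
Let wt (x : R * R) := `|x.1 / (x.2 - rho)|.
Let hU (v : R) := `|(1 - expR (- (a * v))) / (a * v)|.
Let X w := (V w, rate w, N w).
Let VR w := (V w, rate w).

Let mwt : measurable_fun setT wt.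
Proof.
apply: measurableT_comp => //; apply: measurable_funM => //.
by apply: (measurableT_comp (@measurable_invr R)); exact: measurable_funB.
Qed.

Let mhU : measurable_fun setT hU.
Proof.
apply: measurableT_comp => //; apply: measurable_funM => //.
  apply: measurable_funB => //; apply: measurableT_comp => //.
  by apply: measurableT_comp => //; exact: measurable_funM.
by apply: (measurableT_comp (@measurable_invr R)); exact: measurable_funM.
Qed.

Let mX : measurable_fun setT X.
Proof. by apply: measurable_fun_pair => //; exact: measurable_fun_pair. Qed.

Let mVR : measurable_fun setT VR.
Proof. exact: measurable_fun_pair. Qed.

Let mNn n : measurable [set w | N w = n].
Proof.
rewrite (_ : [set _ | _] = N @^-1` [set n])//.
by rewrite -[X in measurable X]setTI; exact: mN.
Qed.

Lemma integral_uniform_expR v : 0 < v ->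
  (\int[pushforward P U]_u (expR (- (a * (u * v))))%:E = (hU v)%:E)%E.
Proof.
move=> v0; pose f (u : R) := (expR (- (a * (u * v))))%:E.
have mf : measurable_fun setT f.
  apply/measurable_EFinP; apply: measurableT_comp => //.
  by apply: measurableT_comp => //; apply: measurable_funM => //; exact: measurable_funM.
have av : 0 < a * v by rewrite mulr_gt0.
pose U2 : Omega -> measurableTypeR R := U.
have mU2 : measurable_fun setT U2 by exact: mU.
have f0 u : (0 <= f u)%E by rewrite lee_fin expR_ge0.
transitivity (\int[uniform_prob (@ltr01 R)]_u f u)%E.
  transitivity (\int[P]_w f (U w))%E; first by rewrite ge0_integral_pushforward.
  transitivity (\int[pushforward P U2]_u f u)%E.
    by rewrite ge0_integral_pushforward.
  by apply: eq_measure_integral => A mA _; exact: U_uniform.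
rewrite integral_uniform// subr0 invr1 mul1e.
have k0 : - (a * v) != 0 by rewrite oppr_eq0 gt_eqF.
have hp : 0 < 1 - expR (- (a * v)) by rewrite subr_gt0 expR_lt1 oppr_lt0.
pose g (u : R) := (- (a * v) * expR (- (a * v) * (u - 0)))%:E.
have mg : measurable_fun setT g.
  apply/measurable_EFinP; apply: measurable_funM => //; apply: measurableT_comp => //.
  by apply: measurable_funM => //; exact: measurable_funB.
transitivity (\int[lebesgue_measure]_(u in `[0%R, 1%R]) ((a * v)^-1%:E * - g u))%E.
  apply: eq_integral => u _; rewrite /f /g -EFinN -EFinM; congr EFin.
  rewrite mulNr opprK mulKf ?gt_eqF//; congr expR; ring.
rewrite ge0_integralZl_EFin//; last 3 first.
- move=> u _; rewrite /g -EFinN lee_fin mulNr opprK mulr_ge0 ?expR_ge0//.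
  exact: ltW.
- by apply: measurableT_comp => //; exact: measurable_funTS.
- by rewrite invr_ge0 ltW.
have ig : (\int[lebesgue_measure]_(u in `[0%R, 1%R]) g u =
    (expR (- (a * v) * (1 - 0)) - 1)%:E)%E by exact: (integral_expR _ ltr01).
have -> : (\int[lebesgue_measure]_(u in `[0%R, 1%R]) - g u =
    - \int[lebesgue_measure]_(u in `[0%R, 1%R]) g u)%E.
  rewrite -[LHS]oppeK -integral_ge0N; last first.
    move=> u _; rewrite /g -EFinN lee_fin mulNr opprK mulr_ge0 ?expR_ge0//.
    exact: ltW.
  by under eq_integral do rewrite oppeK.
rewrite ig -EFinN -EFinM /hU ger0_norm.
  by congr EFin; rewrite subr0 mulr1 opprB mulrC.
by rewrite divr_ge0// ltW.
Qed.

(** Three averages are taken: the product over the [e i] becomes [q ^ n], the factor in [U] becomes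
    [hU], and the indicator of [N = n] becomes its conditional probability. The maximum with [0] is
    inactive where [rho < rate]. *)
Lemma integral_compound_geometric_term n :
  (\int[P]_(w in [set w | N w = n])
     (wt (VR w) * expR (- (a * (U w * V w + \sum_(i < N w) e i w))))%:E =
   \int[P]_w (q ^+ n * (wt (VR w) * hU (V w) *
     Num.max ((1 - rho / rate w) * (rho / rate w) ^+ n) 0))%:E)%E.
Proof.
pose F (z : R * (R * R * nat)) : \bar R :=
  (wt z.2.1 * \1_[set z | z.2 = n] z.2 * expR (- (a * (z.1 * z.2.1.1))))%:E.
have mz1 : measurable_fun setT (fun z : R * (R * R * nat) => z.2.1).
  exact: (measurableT_comp measurable_fst measurable_snd).
have mF : measurable_fun setT F.
  apply/measurable_EFinP; apply: measurable_funM.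
    apply: measurable_funM; first exact: (measurableT_comp mwt mz1).
    have mI : measurable_fun setT (\1_[set z : R * R * nat | z.2 = n] : R * R * nat -> R).
      apply: measurable_indic.
      rewrite (_ : [set _ | _] = (snd : R * R * nat -> nat) @^-1` [set n])//.
      by rewrite -[X in measurable X]setTI; exact: measurable_snd.
    exact: (measurableT_comp mI measurable_snd).
  apply: measurableT_comp => //; apply: measurableT_comp => //.
  apply: measurable_funM => //; apply: measurable_funM => //.
  exact: (measurableT_comp measurable_fst mz1).
have F0 z : (0 <= F z)%E.
  rewrite /F lee_fin mulr_ge0 ?expR_ge0//; apply: mulr_ge0; first exact: normr_ge0.
  by rewrite indicE ler0n.
transitivity (\int[P]_w (F (U w, X w) * (laplace_prod e a n w)%:E))%E.
  rewrite [LHS]integral_mkcond; apply: eq_integral => w _.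
  rewrite patchE /F /X/= indicE.
  have -> : (w \in [set w | N w = n]) = ((V w, rate w, N w) \in [set z : R * R * nat | z.2 = n]).
    by apply/idP/idP => /set_mem h; exact/mem_set.
  case: ifPn => [/set_mem /= Nn|_]; last by rewrite mulr0 !mul0r mul0e.
  rewrite mulr1 -EFinM -mulrA; congr (_ * _)%:E.
  rewrite /laplace_prod -expR_sum -expRD Nn; congr expR.
  by rewrite mulrDr opprD; congr (_ + _); rewrite mulr_sumr sumrN.
rewrite (integral_laplace_prod mU mX me S0 S1 SS hS laplace_e q_gt0 n mF F0).
have mG : measurable_fun setT (fun w => wt (VR w) * hU (V w)).
  by apply: measurable_funM; [exact: measurableT_comp|exact: measurableT_comp].
pose U' : {mfun Omega >-> R} := HB.pack U (isMeasurableFun.Build _ _ _ _ U mU).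
have -> : (\int[P]_w \int[pushforward P U]_u F (u, X w) =
    \int[P]_w (wt (VR w) * hU (V w) * \1_[set w | N w = n] w)%:E)%E.
  apply: ge0_ae_eq_integral => //.
  - have mGF := @measurable_fun_fubini_tonelli_G _ _ _ _ _ (distribution P U') F mF F0.
    exact: (measurableT_comp mGF mX).
  - by apply/measurable_EFinP; apply: measurable_funM => //; exact: measurable_indic.
  - by move=> w _; apply: integral_ge0.
  - move=> w _; rewrite lee_fin indicE mulr_ge0 ?ler0n//.
    by apply: mulr_ge0; exact: normr_ge0.
  apply: filterS V_gt0 => w Vw _.
  transitivity (\int[distribution P U']_u ((wt (VR w) * \1_[set w | N w = n] w)%:E *
      (expR (- (a * (u * V w))))%:E))%E.
    apply: (@eq_integral _ _ _ (distribution P U')) => u _.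
    have NE : ((V w, rate w, N w) \in [set z : R * R * nat | z.2 = n]) =
        (w \in [set w | N w = n]) by apply/idP/idP => /set_mem h; exact/mem_set.
    by rewrite /F /X -EFinM /= !indicE NE.
  rewrite ge0_integralZl_EFin//; last 2 first.
  - apply/measurable_EFinP; apply: measurableT_comp => //; apply: measurableT_comp => //.
    by apply: measurable_funM => //; exact: measurable_funM.
  - by rewrite indicE mulr_ge0 ?ler0n//; exact: normr_ge0.
  have -> : (\int[distribution P U']_u (expR (- (a * (u * V w))))%:E = (hU (V w))%:E)%E.
    exact: integral_uniform_expR.
  by rewrite -EFinM mulrAC.
have [mg Ng] := N_geom n.
pose g (x : R * R) : R := Num.max ((1 - rho / x.2) * (rho / x.2) ^+ n) 0.
pose G (x : R * R) := (wt x * hU x.1)%:E.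
have mG2 : measurable_fun setT G.
  apply/measurable_EFinP; apply: measurable_funM => //.
  exact: (measurableT_comp mhU measurable_fst).
have mgV : measurable_fun setT (fun w => g (VR w)).
  have mg' : measurable_fun setT g by exact: measurable_maxr.
  exact: (measurableT_comp mg' mVR).
have -> : (\int[P]_w (wt (VR w) * hU (V w) * \1_[set w | N w = n] w)%:E =
    \int[P]_w (G (VR w) * (g (VR w))%:E))%E.
  rewrite -(@integral_comp_density _ _ _ P _ _ VR (\1_[set w | N w = n]) (fun w => g (VR w)) G) //.
  - by move=> w; rewrite /g le_max lexx orbT.
  - move=> C mC; have mVC : measurable (VR @^-1` C).
      by rewrite -[X in measurable X]setTI; exact: mVR.
    rewrite integral_indic//.
    transitivity (\int[P]_(w in VR @^-1` C)
      ((1 - rho / (VR w).2) * (rho / (VR w).2) ^+ n)%:E)%E; first exact: (Ng C mC).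
    apply: ae_eq_integral => //.
    - by apply: measurable_funTS; apply/measurable_EFinP; exact: (measurableT_comp mg mVR).
    - by apply: measurable_funTS; exact/measurable_EFinP.
    apply: filterS rate_gt => w rw _; rewrite /g (max_idPl _)//.
    have r0 : 0 < rate w by exact: le_lt_trans rw.
    rewrite mulr_ge0 ?exprn_ge0 ?divr_ge0 ?(ltW r0)//.
    by rewrite subr_ge0 ler_pdivrMr// mul1r ltW.
  - by move=> y; rewrite /G lee_fin; apply: mulr_ge0; exact: normr_ge0.
rewrite -ge0_integralZl_EFin//; last 3 first.
- move=> w _; apply: mule_ge0; last by rewrite lee_fin /g le_max lexx orbT.
  by rewrite lee_fin; apply: mulr_ge0; exact: normr_ge0.
- apply: emeasurable_funM; last exact/measurable_EFinP.
  exact: measurableT_comp.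
- by rewrite exprn_ge0// ltW.
Qed.

Lemma integral_compound_geometric eta_a : q * rho = eta_a / a ->
  (\int[P]_w (V w / (rate w - rho) *
     expR (- (a * (U w * V w + \sum_(i < N w) e i w))))%:E =
   \int[P]_w ((1 - expR (- (a * V w))) / (a * rate w - eta_a))%:E)%E.
Proof.
move=> qE.
pose E w := expR (- (a * (U w * V w + \sum_(i < N w) e i w))).
have msum n : measurable_fun setT (fun w => \sum_(i < n) e i w).
  elim: n => [|n ih].
    rewrite (_ : (fun _ => _) = cst 0); first exact: measurable_cst.
    by apply/funext => w; rewrite big_ord0.
  rewrite (_ : (fun _ => _) = (fun w => \sum_(i < n) e i w + e n w)).
    exact: measurable_funD.
  by apply/funext => w; rewrite big_ord_recr.
have mE : measurable_fun setT E.
  apply: measurableT_comp => //; apply: measurableT_comp => //.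
  apply: measurable_funM => //; apply: measurable_funD; first exact: measurable_funM.
  (* A sum with a random number of terms is a fixed sum on each event [N = n]. *)
  move=> _ B mB; rewrite setTI.
  rewrite (_ : _ @^-1` _ = \bigcup_n ([set w | N w = n] `&`
      (fun w => \sum_(i < n) e i w) @^-1` B)).
    apply: bigcup_measurable => n _; apply: measurableI => //.
    rewrite -[X in measurable X]setTI.
    exact: msum.
  apply/seteqP; split => w /=; first by exists (N w).
  by move=> [n _ [<-]].
have mwtVR : measurable_fun setT (fun w => wt (VR w)) by exact: measurableT_comp.
have mload : measurable_fun setT (fun w => V w / (rate w - rho)).
  apply: measurable_funM => //; apply: (measurableT_comp (@measurable_invr R)).
  exact: measurable_funB.
transitivity (\int[P]_w (wt (VR w) * E w)%:E)%E.
  apply: ae_eq_integral => //.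
  - by apply/measurable_EFinP; exact: measurable_funM.
  - by apply/measurable_EFinP; exact: measurable_funM.
  apply: filterS2 V_gt0 rate_gt => w Vw rw _.
  by rewrite /wt /VR/= ger0_norm// divr_ge0 ?subr_ge0// ltW.
have cover : [set: Omega] = \bigcup_n [set w | N w = n].
  by apply/seteqP; split => w // _; exists (N w).
rewrite cover ge0_integral_bigcup//; last 3 first.
- by apply: measurable_funTS; apply/measurable_EFinP; exact: measurable_funM.
- by move=> w _; rewrite lee_fin; apply: mulr_ge0; [exact: normr_ge0|exact: expR_ge0].
- by apply/trivIsetP => i j _ _ /eqP ij; apply/seteqP; split => w //= [h1 h2]; apply: ij; rewrite -h1 -h2.
pose t n w : R := q ^+ n * (wt (VR w) * hU (V w) *
  Num.max ((1 - rho / rate w) * (rho / rate w) ^+ n) 0).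
have mt n : measurable_fun setT (t n).
  apply: measurable_funM => //; apply: measurable_funM.
    by apply: measurable_funM => //; exact: measurableT_comp.
  apply: measurable_maxr => //; have [mg _] := N_geom n.
  exact: (measurableT_comp mg mVR).
have t0 n w : 0 <= t n w.
  apply: mulr_ge0; first by rewrite exprn_ge0// ltW.
  apply: mulr_ge0; last by rewrite le_max lexx orbT.
  by apply: mulr_ge0; exact: normr_ge0.
transitivity (\sum_(0 <= n <oo) \int[P]_w (t n w)%:E)%E.
  by apply: eq_eseriesr => n _; exact: integral_compound_geometric_term.
rewrite -integral_nneseries//; last 2 first.
- by move=> n; exact/measurable_EFinP.
- by move=> n w _; rewrite lee_fin.
rewrite -cover; apply: ae_eq_integral => //.
- apply: (emeasurable_fun_cvg (fun n w => \sum_(0 <= i < n) (t i w)%:E)%E).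
    by move=> n; apply: emeasurable_sum => i; exact/measurable_EFinP.
  by move=> w _; apply: is_cvg_nneseries => n _ _; rewrite lee_fin.
- apply/measurable_EFinP; apply: measurable_funM.
    apply: measurable_funB => //; apply: measurableT_comp => //.
    by apply: measurableT_comp => //; exact: measurable_funM.
  apply: (measurableT_comp (@measurable_invr R)).
  by apply: measurable_funB => //; exact: measurable_funM.
apply: filterS2 V_gt0 rate_gt => w Vw rw _.
have r0 : 0 < rate w by exact: le_lt_trans rw.
pose x := rho / rate w.
have x0 : 0 <= x by rewrite divr_ge0// ltW.
have x1 : x < 1 by rewrite /x ltr_pdivrMr// mul1r.
have qx0 : 0 <= q * x by rewrite mulr_ge0// ltW.
have qx1 : q * x < 1 by apply: le_lt_trans x1; rewrite ler_piMl.
pose K := wt (VR w) * hU (V w) * (1 - x).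
have tE n : t n w = geometric K (q * x) n.
  have pos : 0 <= (1 - x) * x ^+ n by rewrite mulr_ge0 ?exprn_ge0// subr_ge0 ltW.
  by rewrite /t -/x (max_idPl pos) /geometric/= /K [(q * x) ^+ n]exprMn; move: (x ^+ n) (q ^+ n) => y z; ring.
have cv : series (geometric K (q * x)) @ \oo --> K / (1 - q * x).
  by apply: cvg_geometric_series; rewrite ger0_norm.
apply/cvg_lim => //.
rewrite (_ : (fun n => _) = EFin \o series (geometric K (q * x))); last first.
  apply/funext => n; rewrite /= /series/= sumEFin; congr EFin.
  by apply: eq_bigr => i _; rewrite tE.
apply: cvg_EFin; first exact: nearW.
have av : 0 < a * V w by rewrite mulr_gt0.
have hp : 0 < 1 - expR (- (a * V w)) by rewrite subr_gt0 expR_lt1 oppr_lt0.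
suff <- : K / (1 - q * x) = (1 - expR (- (a * V w))) / (a * rate w - eta_a) by exact: cv.
have rr : 0 < rate w - rho by rewrite subr_gt0.
have etaE : eta_a = a * (q * rho) by rewrite qE; field; rewrite gt_eqF.
have den : 0 < rate w - q * rho.
  by rewrite subr_gt0; apply: le_lt_trans rw; rewrite ler_piMl.
rewrite /K /wt /hU /VR/= !ger0_norm ?divr_ge0 ?(ltW hp) ?(ltW av) ?(ltW rr) ?(ltW Vw)//.
rewrite /x etaE; field.
by rewrite !gt_eqF//= -mulrBr mulr_gt0.
Qed.

End compound_geometric.

(** * Reduction to a finite stopping time *)

Section finite_stopping_time.
Context d (Omega : measurableType d) (R : realType).
Variables (P : probability Omega R) (F : R -> set (set Omega)) (tau : Omega -> \bar R).
Hypothesis hF : is_filtration F.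
Hypothesis hFusual : usual_conditions P F.
Hypothesis htau : is_stopping_time F tau.
Hypothesis htaumean : (\int[P]_w tau w < +oo)%E.

Let Falg t : 0 <= t -> sigma_algebra setT (F t).
Proof. exact: filtration_sigma_algebra. Qed.

(** [n] times the probability of this event is at most the finite mean of [tau], for every [n]. *)
Lemma stopping_infinite_negligible : P.-negligible [set w | tau w = +oo%E].
Proof.
have [tau0 stop] := htau.
have m n : measurable [set w | (tau w <= n%:R%:E)%E].
  by apply: (filtration_measurable hF (ler0n R n)); apply: stop.
have E : [set w | tau w = +oo%E] = ~` \bigcup_n [set w | (tau w <= n%:R%:E)%E].
  apply/seteqP; split => w /=; first by move=> h [n _ /=]; rewrite h leye_eq.
  move=> h; apply/eqP; rewrite -leye_eq leNgt; apply/negP => fin; apply: h.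
  have tf : tau w \is a fin_num by rewrite ge0_fin_numE.
  exists (Num.truncn (fine (tau w))).+1 => //=.
  by rewrite -(fineK tf) lee_fin; exact/ltW/truncnS_gt.
have mE : measurable [set w | tau w = +oo%E].
  by rewrite E; apply: measurableC; apply: bigcup_measurable => n _; exact: m.
apply/negligibleP => //.
have h n : (n%:R%:E * P [set w | tau w = +oo%E] <= \int[P]_w tau w)%E.
  rewrite -integral_cst// integral_mkcond; apply: le_integral_nonmeasurable => w.
    by apply: erestrict_ge0 => ? _; rewrite lee_fin ler0n.
  by rewrite patchE; case: ifPn => [/set_mem /= ->|_]; rewrite ?leey.
have pf := fin_num_measure P _ mE.
have If : (\int[P]_w tau w)%E \is a fin_num.
  by rewrite ge0_fin_numE//; apply: integral_ge0.
apply/eqP; rewrite eq_le measure_ge0 andbT -(fineK pf) lee_fin leNgt; apply/negP => p0.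
pose n := (Num.truncn (fine (\int[P]_w tau w)%E / fine (P [set w | tau w = +oo%E]))).+1.
have := h n; rewrite -(fineK pf) -(fineK If) -EFinM lee_fin -ler_pdivlMr//.
by rewrite leNgt truncnS_gt.
Qed.

Lemma null_adapted t A : 0 <= t -> A `<=` [set w | tau w = +oo%E] -> F t A.
Proof.
move=> t0 AT; apply: (filtration_nondecreasing hF (lexx 0) t0).
apply: (usual_complete hFusual).
exact: negligibleS AT stopping_infinite_negligible.
Qed.

(* The completeness of [F 0] absorbs the null event where [tau] is infinite. *)
Lemma fine_stopping_event t A : 0 <= t -> F t (A `&` [set w | (tau w <= t%:E)%E]) ->
  F t (A `&` [set w | fine (tau w) <= t]).
Proof.
have [tau0 _] := htau; move=> t0 FA.
rewrite (_ : _ `&` _ = (A `&` [set w | (tau w <= t%:E)%E]) `|`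
    (A `&` [set w | tau w = +oo%E])).
  by apply: (sigma_algebra_setU (Falg t0)) => //; apply: null_adapted => // w [].
apply/seteqP; split => w /=; have := tau0 w; case: (tau w) => [r| |] //=.
- by rewrite !lee_fin => _ [Aw rt]; left.
- by move=> _ [Aw _]; right.
- by rewrite !lee_fin => _ [[]|[]].
- by move=> _ [[]|[]].
Qed.

Lemma fine_stopping t : 0 <= t -> F t [set w | fine (tau w) <= t].
Proof.
move=> t0; have [_ stop] := htau.
have := @fine_stopping_event t setT t0; rewrite !setTI; apply; exact: stop.
Qed.

Lemma stopped_shifted_sigma : stopped_sigma F tau `<=` shifted_sigma F (fine \o tau) 0.
Proof.
move=> A [mA FA]; split => // t t0.
have := fine_stopping_event t0 (FA t t0).
by rewrite (_ : [set w | fine (tau w) <= t] = [set w | (fine \o tau) w + 0 <= t])//;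
  apply/seteqP; split => w /=; rewrite addr0.
Qed.

End finite_stopping_time.

Lemma integral_probability_cst d (Omega : measurableType d) (R : realType)
  (P : probability Omega R) (r : R) : (\int[P]_w r%:E = r%:E)%E.
Proof.
by rewrite -[RHS]mule1 -(probability_setT P); exact: (integral_cst P measurableT r%:E).
Qed.

(** * Behaviour of the Laplace exponent near zero *)

Section laplace_exponent_bounds.
Context d (Omega : measurableType d) (R : realType).
Variables (P : probability Omega R) (X : Omega -> R) (eta : R -> R).
Hypothesis mX : measurable_fun setT X.
Hypothesis X0 : forall w, 0 <= X w.
Hypothesis EX_fin : ('E_P[X] < +oo)%E.
Hypothesis laplace_X : forall a, 0 <= a -> laplace P X a = (expR (- eta a))%:E.

Local Notation rho := (fine 'E_P[X])%E.

Let EXE : (rho%:E = \int[P]_w (X w)%:E)%E.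
Proof.
have -> : (\int[P]_w (X w)%:E = 'E_P[X])%E by rewrite unlock.
rewrite fineK// ge0_fin_numE// unlock; apply: integral_ge0 => w _.
by rewrite lee_fin.
Qed.

Let laplaceE a : 0 <= a -> (\int[P]_w (expR (- (a * X w)))%:E = (expR (- eta a))%:E)%E.
Proof. by move=> a0; rewrite -laplace_X// /laplace unlock. Qed.

Lemma mean_ge0 : 0 <= rho.
Proof. by rewrite -lee_fin EXE; apply: integral_ge0 => w _; rewrite lee_fin. Qed.

Let mexp a : measurable_fun setT (fun w => expR (- (a * X w))).
Proof.
apply: measurableT_comp => //; apply: measurableT_comp => //.
exact: measurable_funM.
Qed.

(* Jensen: the exponential lies above its tangent at the mean. *)
Lemma laplace_exponent_le a : 0 <= a -> eta a <= rho * a.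
Proof.
move=> a0; set m := rho * a.
rewrite -lerN2 -ler_expR.
(* The tangent inequality for [exp (- x)] at [m], with its negative term moved across so that both
   sides are nonnegative and integrals add without integrability conditions. *)
have h : ((expR (- m) * (1 + m))%:E <= \int[P]_w ((expR (- (a * X w)))%:E +
    (expR (- m) * a)%:E * (X w)%:E))%E.
  have m0 : 0 <= m by rewrite mulr_ge0// mean_ge0.
  have -> : ((expR (- m) * (1 + m))%:E = \int[P]_w (expR (- m) * (1 + m))%:E)%E.
    exact/esym/integral_probability_cst.
  apply: ge0_le_integral => //.
  - by move=> w _; rewrite lee_fin mulr_ge0 ?expR_ge0// addr_ge0.
  - apply: emeasurable_funD; first exact/measurable_EFinP.
    by apply: emeasurable_funM => //; exact/measurable_EFinP.
  - move=> w _; rewrite -EFinM -EFinD lee_fin.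
    have := expR_ge1Dx (m - a * X w); rewrite expRD => h.
    have e0 := expR_gt0 (- m).
    have : expR (- m) * (1 + (m - a * X w)) <= expR (- m) * (expR m * expR (- (a * X w))).
      by rewrite ler_pM2l.
    rewrite [X in _ <= X -> _]mulrA -expRD addNr expR0 mul1r; nra.
rewrite ge0_integralD// in h; last 3 first.
- exact/measurable_EFinP.
- by move=> w _; rewrite mule_ge0// lee_fin ?mulr_ge0 ?expR_ge0.
- by apply: emeasurable_funM => //; exact/measurable_EFinP.
rewrite ge0_integralZl_EFin// in h; last 3 first.
- by move=> w _; rewrite lee_fin.
- exact/measurable_EFinP.
- by rewrite mulr_ge0 ?expR_ge0.
rewrite laplaceE// -EXE -EFinM -EFinD lee_fin in h.
by move: h; rewrite /m; nra.
Qed.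

(** Only the transform of [X] enters. The quotients [(1 - exp (- h X)) / h] converge to [X] and are
    dominated by it, so [(1 - exp (- eta h)) / h] tends to the mean; then
    [1 - exp (- eta h) <= eta h <= rho * h] squeezes. *)
Lemma cvg_laplace_exponent_div :
  eta m.+1%:R^-1 / m.+1%:R^-1 @[m --> \oo] --> rho.
Proof.
pose h (m : nat) : R := m.+1%:R^-1.
have h0 m : 0 < h m by rewrite invr_gt0.
pose f m w := (1 - expR (- (h m * X w))) / h m.
have mf m : measurable_fun setT (f m).
  by apply: measurable_funM => //; apply: measurable_funB => //; exact: mexp.
have fle m w : X w / (1 + h m * X w) <= f m w <= X w.
  have hx : 0 <= h m * X w by rewrite mulr_ge0// ltW.
  have den : 0 < 1 + h m * X w by rewrite ltr_wpDr.
  apply/andP; split; last first.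
    rewrite ler_pdivrMr//; have := expR_ge1Dx (- (h m * X w)); lra.
  rewrite /f ler_pdivlMr// mulrAC ler_pdivrMr// mulrBl mul1r lerBrDr expRN.
  rewrite [X w * _]mulrC [leLHS]addrC lerD2r mulrC ler_pdivrMr ?expR_gt0// mul1r.
  exact: expR_ge1Dx.
have f0 m w : 0 <= f m w.
  by rewrite divr_ge0 ?(ltW (h0 m))// subr_ge0 expR_le1 oppr_le0 mulr_ge0// ltW.
have fE m : (\int[P]_w (f m w)%:E = ((1 - expR (- eta (h m))) / h m)%:E)%E.
  have e1 : (\int[P]_w ((f m w)%:E + (expR (- (h m * X w)) / h m)%:E) = ((h m)^-1)%:E)%E.
    transitivity (\int[P]_w (h m)^-1%:E)%E.
      by apply: eq_integral => w _; rewrite -EFinD; congr EFin; rewrite /f; ring.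
    exact: integral_probability_cst.
  have mm : measurable_fun setT (fun w => (expR (- (h m * X w)) / h m)%:E).
    by apply/measurable_EFinP; apply: measurable_funM => //; exact: mexp.
  rewrite ge0_integralD// in e1; last 3 first.
  - by move=> w _; rewrite lee_fin.
  - exact/measurable_EFinP.
  - by move=> w _; rewrite lee_fin divr_ge0 ?expR_ge0// ltW.
  have e2 : (\int[P]_w (expR (- (h m * X w)) / h m)%:E = (expR (- eta (h m)) / h m)%:E)%E.
    under eq_integral do rewrite mulrC EFinM.
    rewrite ge0_integralZl_EFin//; last 2 first.
    - exact/measurable_EFinP.
    - by rewrite invr_ge0 ltW.
    by rewrite laplaceE ?ltW// -EFinM mulrC.
  rewrite e2 in e1.
  have := congr1 (fun x => x - (expR (- eta (h m)) / h m)%:E)%E e1.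
  by rewrite addeK// => ->; rewrite -EFinB; congr EFin; ring.
have cv : (\int[P]_w (f m w)%:E @[m --> \oo] --> \int[P]_w (X w)%:E)%E.
  apply: (@dominated_cvg _ _ _ _ _ measurableT _ _ (fun w => (X w)%:E)) => //.
  - by move=> m; exact/measurable_EFinP.
  - move=> w _; apply: cvg_EFin; first exact: nearW.
    apply: (@squeeze_cvgr _ _ _ _ (fun m => X w / (1 + h m * X w)) (cst (X w))).
    + by apply: nearW => m; exact: fle.
    + rewrite -[X in _ --> X]divr1; apply: cvgZr; apply: cvgV; first by rewrite oner_neq0.
      rewrite -[X in _ --> X]addr0; apply: cvgD; first exact: cvg_cst.
      by rewrite -[X in _ --> X](mul0r (X w)); apply: cvgZl; exact: cvg_harmonic.
    + exact: cvg_cst.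
  - apply/integrableP; split; first exact/measurable_EFinP.
    by under eq_integral do rewrite gee0_abs ?lee_fin//; rewrite -EXE ltry.
  - by move=> m w _; rewrite gee0_abs ?lee_fin//; have /andP[] := fle m w.
rewrite -EXE (funext fE) in cv.
have cv' : (1 - expR (- eta (h m))) / h m @[m --> \oo] --> rho by exact: fine_cvg cv.
apply: (@squeeze_cvgr _ _ _ _ (fun m => (1 - expR (- eta (h m))) / h m) (cst rho)) => //.
  apply: nearW => m; rewrite ler_pM2r ?invr_gt0//; apply/andP; split.
    by have := expR_ge1Dx (- eta (h m)); rewrite /h; lra.
  by rewrite ler_pdivrMr//; apply: laplace_exponent_le; exact: ltW.
exact: cvg_cst.
Qed.

End laplace_exponent_bounds.

Lemma integral_full_event d (Omega : measurableType d) (R : realType)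
    (P : probability Omega R) (D : set Omega) (f : Omega -> \bar R) :
  measurable D -> measurable_fun setT f -> {ae P, forall w, D w} ->
  (\int[P]_(w in D) f w = \int[P]_w f w)%E.
Proof.
move=> mD mf aeD; rewrite integral_mkcond; apply: ae_eq_integral => //.
  by apply/(measurable_restrictT _ _).1 => //; exact: measurable_funTS.
by apply: filterS aeD => w Dw _; rewrite patchE mem_set.
Qed.

(* e n is the variable written e_(n+1) in a 1-based indexing. *)
Theorem theorem1 (d : measure_display) (Omega : measurableType d)
  (R : realType) (P : probability Omega R)
  (F : R -> set (set Omega))
  (J : R -> Omega -> R) (c : R) (nu : {measure set R -> \bar R})
  (tau : Omega -> \bar R) (rate : Omega -> R)
  (U : {RV P >-> R}) (N : {RV P >-> nat}) (e : nat -> {RV P >-> R})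
  (eta := laplace_exponent c nu)
  (rho := mean_rate P J)
  (V := level_at_tau J tau)
  (hF : is_filtration F)
  (hFusual : usual_conditions P F)
  (hJ : is_subordinator P F J c nu)
  (hJmean : ('E_P[J 1%R] < +oo)%E)
  (htau : is_stopping_time F tau)
  (htaumean : (\int[P]_w tau w < +oo)%E)
  (hV : {ae P, forall w, 0 < V w})
  (hrate_meas : sigma_gen rate `<=` stopped_sigma F tau)
  (hrate : {ae P, forall w, rho < rate w})
  (hVR : ('E_P[fun w => (V w / (rate w - rho))%R] < +oo)%E)
  (hU : forall B : set R, measurable B ->
     distribution P U B = uniform_prob (@ltr01 R) B)
  (he_ge0 : forall n, {ae P, forall w, 0 <= e n w})
  (he_id : forall n (B : set R), measurable B ->
     distribution P (e n) B = distribution P (e 0%N) B)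
  (he_laplace : forall a, 0 <= a ->
     laplace P (e 0%N) a = (excess_laplace P J eta a)%:E)
  (hN : forall n : nat,
     is_cond_prob P [set w | N w = n] (fun w => (V w, rate w))
       (fun vr : R * R => (1 - rho / vr.2) * (rho / vr.2) ^+ n))
  (hindep : mutually_indep P (source_sigma J tau rate U N e))
  (a : R) (ha : 0 <= a) :
  on_transform P J tau rate a =
    ('E_P[transform_quotient P J tau rate eta a]
       / 'E_P[fun w => (V w / (rate w - rho))%R])%E
  /\
  ('E_P[transform_quotient P J tau rate eta a]
       / 'E_P[fun w => (V w / (rate w - rho))%R])%E =
    E_VR P J tau rate
      (fun w => expR (- (a * (U w * V w + \sum_(i < N w) e i w)))).

Proof.
(* A real-valued version of [tau], equal to [0] on the null event where [tau] is infinite, in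
   agreement with [level_at_tau] and [on_process]. *)
pose sigma := fine \o tau.
have sigma_ge0 w : 0 <= sigma w by apply: fine_ge0; case: htau.
have sigma_stop t : 0 <= t -> F t [set w | sigma w <= t].
  exact: (fine_stopping hF hFusual htau htaumean).
pose G := shifted_sigma F sigma.
pose L s w := J (sigma w + s) w.
have G_sigma s : 0 <= s -> sigma_algebra setT (G s).
  exact: (shifted_sigma_algebra hF sigma_ge0 sigma_stop).
have G_measurable s : G s `<=` measurable by move=> A; exact: shifted_sigma_measurable.
have G_nd s t : 0 <= s -> s <= t -> G s `<=` G t.
  exact: (shifted_sigma_nondecreasing hF sigma_ge0 sigma_stop).
have rate_G : measurable_fun (setT : set (g_sigma_algebraType (G 0))) rate.
  move=> _ B mB; rewrite setTI (measurable_g_sigma_algebraE (G_sigma 0 (lexx 0))).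
  apply: (stopped_shifted_sigma hF hFusual htau htaumean); apply: hrate_meas.
  by exists B => //; rewrite setTI.
have L_G s : 0 <= s -> measurable_fun (setT : set (g_sigma_algebraType (G s))) (L s).
  exact: (after_stopping_adapted hF hFusual hJ sigma_ge0 sigma_stop).
(* Random-time sampling on the product space, where [sigma + max 0 s] is a function of the pair. *)
have L_joint : measurable_fun setT (fun z : Omega * R => L (Num.max 0 z.2) z.1).
  have msig : measurable_fun setT sigma by exact: (measurable_stopping hF sigma_ge0 sigma_stop).
  apply: (@measurable_random_time _ _ _ (fun s (z : Omega * R) => J s z.1)
    (fun z : Omega * R => sigma z.1 + Num.max 0 z.2)).
  - move=> s s0; apply: (measurableT_comp _ measurable_fst).
    exact: (measurable_subordinator hF hJ s0).
  - apply: measurable_funD; first exact: (measurableT_comp msig measurable_fst).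
    exact: measurable_maxr.
  - by move=> z; rewrite addr_ge0// le_max lexx.
  - move=> z; apply: (subordinator_right_continuous hJ).
    by rewrite addr_ge0// le_max lexx.
have L_ge0 w : 0 <= L 0 w.
  by apply: (subordinator_ge0 hJ); rewrite addr0.
have L_nd w s t : 0 <= s -> s <= t -> L s w <= L t w.
  move=> s0 st; apply: (subord_nondecreasing hJ); first by rewrite addr_ge0.
  by rewrite lerD2l.
have L_rc w t : 0 <= t -> L x w @[x --> t^'+] --> L t w.
  move=> t0; apply/cvg_at_rightP => u [ut cu].
  have /cvg_at_rightP := subordinator_right_continuous hJ (w := w) (addr_ge0 (sigma_ge0 w) t0).
  apply; split; first by move=> n; rewrite ltrD2l.
  by apply: cvgD => //; exact: cvg_cst.
have L_markov := strong_markov_laplace hF hJ sigma_ge0 sigma_stop.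
have mJ1 : measurable_fun setT (J 1) by exact: (measurable_subordinator hF hJ ler01).
have J1_ge0 w : 0 <= J 1 w by exact: (subordinator_ge0 hJ).
have laplaceJ1 b : 0 <= b -> laplace P (J 1) b = (expR (- eta b))%:E.
  by move=> b0; rewrite (subord_laplace hJ b0 ler01) mulr1.
have rho_ge0 : 0 <= rho := mean_ge0 J1_ge0 hJmean.
have eta_le b : 0 <= b -> eta b <= rho * b.
  exact: (laplace_exponent_le mJ1 J1_ge0 hJmean laplaceJ1).
have eta_cvg : eta m.+1%:R^-1 / m.+1%:R^-1 @[m --> \oo] --> rho.
  exact: (cvg_laplace_exponent_div mJ1 J1_ge0 hJmean laplaceJ1).
have L0 : L 0 = V by apply/funext => w; rewrite /L addr0.
have mV : measurable_fun setT V.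
  by rewrite -L0; exact: (Gfun_measurable G_sigma G_measurable (lexx 0) (L_G 0 (lexx 0))).
have mrate : measurable_fun setT rate := measurable_rate G_sigma G_measurable rate_G.
have aep : {ae P, forall w, stable L rate rho w}.
  by apply: filterS2 hrate hV => w rw Vw; split => //; rewrite L0.
have mstable : measurable (stable L rate rho).
  exact: (measurable_stable G_sigma G_measurable rate_G L_G).
pose w_ w := V w / (rate w - rho).
have loadE : load L rate rho = w_ by apply/funext => w; rewrite /load L0.
have mw_ : measurable_fun setT (fun w => (w_ w)%:E).
  apply/measurable_EFinP; rewrite -loadE.
  exact: (measurable_load G_sigma G_measurable rate_G L_G).
have load_int : (\int[P]_(w in stable L rate rho) (load L rate rho w)%:E = \int[P]_w (w_ w)%:E)%E.
  by rewrite loadE; exact: integral_full_event.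
have load_fin : (\int[P]_(w in stable L rate rho) (load L rate rho w)%:E < +oo)%E.
  by rewrite load_int; move: hVR; rewrite unlock.
have key b : 0 <= b -> (\int[P]_w \int[lebesgue_measure]_(s in
       [set s : R | (0 <= s)%R /\ s%:E <= on_duration J tau rate w])
       (expR (- (b * on_process J tau rate s w)))%:E =
    \int[P]_w (transform_quotient P J tau rate eta b w)%:E)%E.
  move=> b0.
  have := integral_busy_period G_sigma G_measurable G_nd rate_G L_G L_joint L_ge0
    L_nd L_markov L_rc rho_ge0 eta_le load_fin eta_cvg b0 aep.
  move=> /[dup] H; rewrite /workload /busy_period => ->.
  rewrite integral_full_event//.
    apply: eq_integral => w _; rewrite /transform_quotient; congr EFin.
    by case: ifP => _; rewrite ?loadE// /laplace_quotient L0.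
  case: (b == 0); first by rewrite loadE.
  apply/measurable_EFinP.
  exact: (measurable_laplace_quotient _ G_sigma G_measurable G_nd rate_G L_G).
(* The denominator is the case of discount rate [0]: the inner integral is then the length of
   [[0, T]], which is [T] itself, infinite values included. *)
have den : (\int[P]_w on_duration J tau rate w = 'E_P[fun w => (V w / (rate w - rho))%R])%E.
  transitivity (\int[P]_w (transform_quotient P J tau rate eta 0 w)%:E)%E; last first.
    by rewrite unlock; apply: eq_integral => w _; rewrite /transform_quotient eqxx.
  rewrite -key//; apply: eq_integral => w _.
  under eq_integral do rewrite mul0r oppr0 expR0.
  have d0 : (0 <= on_duration J tau rate w)%E.
    by apply: le_ereal_inf_tmp => _ [s [s0 _] <-]; rewrite lee_fin.
  case: (on_duration J tau rate w) d0 => [r| |] //= d0.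
  - rewrite (_ : [set _ | _] = `[0, r]%classic); last first.
      by apply/seteqP; split => s /=; rewrite in_itv/= lee_fin => /andP.
    transitivity (lebesgue_measure (`[0, r]%classic : set R)); last first.
      by rewrite integral_cst// mul1e.
    rewrite lebesgue_measure_itv/= lte_fin.
    move: d0; rewrite lee_fin le_eqVlt => /predU1P[<-|r0]; first by rewrite ltxx.
    by rewrite r0 oppr0 adde0.
  - rewrite (_ : [set _ | _] = `[0, +oo[%classic); last first.
      by apply/seteqP; split => s /=; rewrite in_itv/= andbT leey => // -[].
    transitivity (lebesgue_measure (`[0, +oo[%classic : set R)); last first.
      by rewrite integral_cst// mul1e.
    by rewrite lebesgue_measure_itv/= ltry oppr0 adde0.
split.
  by rewrite /on_transform (key a ha) den unlock.
rewrite /E_VR; congr (_ / _)%E; rewrite unlock.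
have [->|an0] := eqVneq a 0.
  by apply: eq_integral => w _; rewrite /transform_quotient eqxx mul0r oppr0 expR0 mulr1.
have a0 : 0 < a by rewrite lt_neqAle eq_sym an0.
pose q := excess_laplace P J eta a.
have laplace_e n : laplace P (e n) a = q%:E.
  rewrite -(he_laplace a ha) /laplace unlock.
  pose f (x : R) := (expR (- (a * x)))%:E.
  have mf : measurable_fun setT f.
    apply/measurable_EFinP; apply: measurableT_comp => //.
    by apply: measurableT_comp => //; exact: measurable_funM.
  have f0 x : (0 <= f x)%E by rewrite lee_fin expR_ge0.
  have tr k : (\int[P]_w (expR (- (a * e k w)))%:E = \int[distribution P (e k)]_x f x)%E.
    by rewrite ge0_integral_pushforward.
  rewrite [LHS]tr [RHS]tr; apply: eq_measure_integral => A mA _; exact: he_id.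
(* [q] is the mean of a strictly positive variable. Its positivity allows the weights to be
   normalized, and it also yields [rho > 0]. *)
have q0 : 0 < q.
  have : (0 < laplace P (e 0%N) a)%E; last by rewrite laplace_e lte_fin.
  rewrite /laplace unlock lt_neqAle; apply/andP; split; last first.
    by apply: integral_ge0 => w _; rewrite lee_fin expR_ge0.
  rewrite eq_sym; apply/negP => /eqP i0.
  have me : measurable_fun setT (fun w => (expR (- (a * e 0%N w)))%:E).
    apply/measurable_EFinP; apply: measurableT_comp => //.
    by apply: measurableT_comp => //; exact: measurable_funM.
  have : ae_eq P setT (fun w => (expR (- (a * e 0%N w)))%:E) (cst 0%E).
    apply/ae_eq_integral_abs => //.
    by under eq_integral do rewrite gee0_abs ?lee_fin ?expR_ge0//.
  move=> [A [mA A0 sub]]; have : P setT = 0%E.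
    apply/eqP; rewrite eq_le measure_ge0 andbT -A0; apply: le_measure; rewrite ?inE//.
    move=> w _; apply: sub => /= /(_ I) /eqP.
    by rewrite eqe gt_eqF// expR_gt0.
  by rewrite probability_setT => /eqP; rewrite eqe oner_eq0.
(* Were [rho] zero, the quotient defining [q] would be [0], by the value [0] given to the inverse of
   [0]. *)
have rho0 : rho != 0.
  apply/eqP => r0; move: q0; rewrite /q /excess_laplace ifN// -/rho r0 mul0r invr0 mulr0.
  by rewrite ltxx.
have rho_gt0 : 0 < rho by rewrite lt_neqAle eq_sym rho0.
have qE : q = eta a / (rho * a) by rewrite /q /excess_laplace ifN.
have q1 : q <= 1.
  by rewrite qE ler_pdivrMr ?mul1r ?eta_le// mulr_gt0.
have qr : q * rho = eta a / a.
  by rewrite qE; field; rewrite rho0 an0.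
transitivity (\int[P]_w ((1 - expR (- (a * V w))) / (a * rate w - eta a))%:E)%E.
  by apply: eq_integral => w _; rewrite /transform_quotient ifN.
apply/esym.
have mU : measurable_fun setT U by [].
have mN : measurable_fun setT N by [].
have me n : measurable_fun setT (e n) by [].
exact: (integral_compound_geometric mV mrate mU mN me (erefl _) (erefl _) (fun n => erefl _)
  hindep laplace_e hU a0 q0 q1 rho_ge0 hV hrate hN qr).
Qed.
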